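(* Let $G$ be a plane elementary bipartite graph. Then $G$ has an anti-forcing edge if and only if $G$ has a perfect matching $M$ such that $G$ has exactly two $M$-resonant faces (the exterior face is allowed to be one of them) and the boundaries of these two faces have a common path of length at least $3$.
   Context: All graphs are finite and simple. A plane graph is a graph embedded in the plane. An edge of a graph is allowed if it belongs to some perfect matching of the graph; a graph $G$ (with a perfect matching) is elementary if its allowed edges form a connected subgraph of $G$ (for a connected bipartite graph this is equivalent to every edge being allowed). An edge $e$ of $G$ is an anti-forcing edge if $G-e$ has a unique perfect matching. For a perfect matching $M$ of $G$, a cycle is $M$-alternating if its edges lie alternately in $M$ and in $E(G)\setminus M$; a face of $G$ is $M$-resonant if its boundary is an $M$-alternating cycle. The length of a path is its number of edges. *)

(* Defs.v *)
From mathcomp Require Import all_boot all_order all_algebra.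
From mathcomp Require Import all_classical all_reals all_analysis.

Set Implicit Arguments.
Unset Strict Implicit.
Unset Printing Implicit Defensive.

Import Order.TTheory GRing.Theory Num.Theory.
Import numFieldNormedType.Exports.

Local Open Scope ring_scope.

(* A finite simple graph on the vertex set T is its set E of edges, an edge   *)
(* being a two-element set of vertices.                                       *)
Section Graphs.
Context {T : finType}.
Implicit Types (E M : {set {set T}}) (f : {set T}) (c p : seq T) (x y : T).

Definition simple_graph E := forall f, f \in E -> #|f| = 2%N.

Definition edge x y : {set T} := (x |: [set y]%SET)%SET.

Definition adj E : rel T := fun x y => edge x y \in E.

Definition bipartite E := exists A : {set T},
  forall x y, adj E x y -> (x \in A) != (y \in A).

Definition perfect_matching E M :=
  (M \subset E) && [forall x, #|[set f in M | x \in f]%SET| == 1%N].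

Definition allowed E : {set {set T}} :=
  [set f in E | [exists M, perfect_matching E M && (f \in M)]]%SET.

(* The vertices of the subgraph formed by a set of edges are the ends of      *)
(* these edges, i.e., the elements of its cover.                              *)
Definition elementary E :=
  (exists M, perfect_matching E M) /\
  {in finset.cover (allowed E) &, forall x y, connect (adj (allowed E)) x y}.

Definition anti_forcing_edge E f :=
  f \in E /\ exists! M, perfect_matching (E :\ f)%SET M.

Definition is_cycle E c := [&& (2 < size c)%N, uniq c & cycle (adj E) c].

Definition is_path E x p := uniq (x :: p) && path (adj E) x p.

Definition alternating_cycle E M c := is_cycle E c &&
  all (fun x => (edge (prev c x) x \in M) != (edge x (next c x) \in M)) c.

Definition cycle_edges c : seq {set T} := [seq edge x (next c x) | x <- c].

Definition path_edges x p : seq {set T} := pairmap edge x p.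

End Graphs.

Local Open Scope classical_set_scope.

Definition frontier {X : topologicalType} (A : set X) : set X :=
  closure A `\` interior A.

(* An edge f is drawn as the simple arc  edge_arc f @` `[0, 1]; the values of *)
(* edge_arc at sets outside E or at reals outside [0, 1] are irrelevant.      *)
Record plane_embedding (R : realType) (T : finType) (E : {set {set T}}) :=
  PlaneEmbedding {
    vertex_point : T -> R * R;
    edge_arc : {set T} -> R -> R * R;
    vertex_point_inj : injective vertex_point;
    edge_arc_continuous : forall f : {set T}, f \in E ->
      {within `[0, 1], continuous (edge_arc f)};
    edge_arc_inj : forall (f : {set T}) (s t : R), f \in E ->
      0 <= s <= 1 -> 0 <= t <= 1 -> edge_arc f s = edge_arc f t -> s = t;
    edge_arc_ends : forall f : {set T}, f \in E ->
      exists x y, [/\ f = edge x y, edge_arc f 0 = vertex_point x &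
                                    edge_arc f 1 = vertex_point y];
    edge_arc_avoids : forall (f : {set T}) (x : T) (t : R), f \in E ->
      0 < t < 1 -> edge_arc f t <> vertex_point x;
    edge_arc_disjoint : forall (f g : {set T}) (s t : R), f \in E -> g \in E ->
      f <> g -> 0 < s < 1 -> 0 < t < 1 -> edge_arc f s <> edge_arc g t }.

Section PlaneGraphs.
Context {R : realType} {T : finType} {E : {set {set T}}}.
Implicit Types (G : plane_embedding R E) (M : {set {set T}}) (F : set (R * R)).

Definition arc_set G (f : {set T}) : set (R * R) := edge_arc G f @` `[0, 1].

Definition drawing G : set (R * R) :=
  range (vertex_point G) `|` \bigcup_(f in [set f | f \in E]) arc_set G f.

Definition face G F := exists2 z, (~` drawing G) z &
  F = connected_component (~` drawing G) z.

Definition resonant_face G M F := face G F /\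
  exists2 c : seq T, alternating_cycle E M c &
    frontier F = \bigcup_(f in [set f | f \in cycle_edges c]) arc_set G f.

(* The edges on the boundary of a face are those whose arc lies in its        *)
(* frontier.                                                                  *)
Definition common_boundary_path G F1 F2 (x : T) (p : seq T) :=
  is_path E x p /\ forall f : {set T}, f \in path_edges x p ->
    arc_set G f `<=` frontier F1 /\ arc_set G f `<=` frontier F2.

End PlaneGraphs.

(* Main.v *)
Require Import Defs.
From mathcomp Require Import all_boot all_order all_algebra.
From mathcomp Require Import ring lra zify.
From mathcomp Require Import all_classical all_reals all_analysis.

(** Let [A] be one class of the bipartition and orient the graph so that the edges
    of a perfect matching [M] leave [A] and all others enter it. The [M]-alternating
    cycles become the directed cycles, and the orientation is strongly connected
    when the graph is elementary with at least three vertices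
    ([strongly_connected]).

    The core is [resonant_in_side]: each of the two sides of a drawn alternating
    cycle contains a resonant face. If nothing is drawn in the side, it is itself
    a face bounded by the cycle. Otherwise strong connectivity yields a directed
    path that runs in the side and joins two vertices of the cycle. The cycle
    already uses the only arc that leaves a vertex of [A] and the only arc that
    enters a vertex outside [A]; so the path starts outside [A] and ends in [A], its
    ends are distinct, and with the part of the cycle that leads back it forms
    a directed cycle with a smaller side.

    Let [M] be the unique perfect matching that avoids an anti-forcing edge [f].
    Every alternating cycle contains [f], since [M] could be exchanged along one
    that does not ([alternating_cycle_swap]). Both sides of one alternating cycle
    contain a resonant face, and there are no others, because at most two faces
    touch [f] ([two_faces_at_edge]). Their boundaries alternate and contain [f],
    which is not in [M], so both contain the matching edges at the two ends of [f].

    Conversely, the common path contains an edge [f] outside [M]. If [M] were not the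
    only perfect matching that avoids [f], then [M] and another one would differ
    along an alternating cycle that avoids [f]. The two given faces both touch [f],
    so they lie in the side of that cycle that contains [f], and the other side
    contains a third resonant face.

    The edges are arbitrary arcs, so this needs the Jordan curve theorem for drawn
    cycles: there are two sides ([cycle_separates], [cycle_two_sides]), and the
    cycle is the frontier of each ([side_frontier]). It is obtained by following
    angles. Two points [p] and [q] off a compact set [K] lie in the same component of
    its complement if and only if the difference of the directions of [z] seen
    from [p] and from [q] has a continuous real determination for [z] in [K]
    ([component_liftable], [two_poles_component]). On an arc all determinations
    exist. An arc that meets [K] in one point therefore separates nothing new
    ([component_add_arc]); for an arc that meets [K] in two points the obstruction is
    one integer, so at most two components arise from one
    ([component_add_arc3]). That two arcs with common ends do separate the plane is
    proved by the dual argument, with the angle under which an arc is seen from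
    a point off the arc ([two_arcs_separate]). *)

Set Implicit Arguments.
Unset Strict Implicit.
Unset Printing Implicit Defensive.

Import Order.TTheory GRing.Theory Num.Theory.
Import numFieldNormedType.Exports.

Local Open Scope ring_scope.
Local Open Scope classical_set_scope.

(** * Angles modulo a full turn *)

Section Angles.
Context {R : realType}.
Implicit Types (a b x y : R) (n : int).

Definition same_angle x y := exists n, x - y = (pi *+ 2) *~ n.

Lemma cosDz x n : cos (x + (pi *+ 2) *~ n) = cos x.
Proof.
case: n => m; first by rewrite -pmulrn; apply: (periodicn (@cosD2pi R)).
rewrite NegzE mulrNz -pmulrn -[in RHS](subrK ((pi *+ 2) *+ m.+1) x).
by rewrite (periodicn (@cosD2pi R)).
Qed.

Lemma sinDz x n : sin (x + (pi *+ 2) *~ n) = sin x.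
Proof.
case: n => m; first by rewrite -pmulrn; apply: (periodicn (@sinD2pi R)).
rewrite NegzE mulrNz -pmulrn -[in RHS](subrK ((pi *+ 2) *+ m.+1) x).
by rewrite (periodicn (@sinD2pi R)).
Qed.

Lemma same_angle_cos x y : same_angle x y -> cos x = cos y.
Proof. by case=> n e; rewrite -(subrK y x) e addrC cosDz. Qed.

Lemma same_angle_sin x y : same_angle x y -> sin x = sin y.
Proof. by case=> n e; rewrite -(subrK y x) e addrC sinDz. Qed.

Lemma cos_eq1 x : cos x = 1 -> exists n, x = (pi *+ 2) *~ n.
Proof.
move=> cx1; set T : R := pi *+ 2.
have T0 : 0 < T by rewrite mulrn_wgt0 ?pi_gt0.
have /andP[] := floor_itv (x / T); set n := Num.floor _ => nlo nhi.
exists n; have /eqP := cx1; rewrite -(subrK (T *~ n) x) cosDz; set r := x - _.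
have r0 : 0 <= r by rewrite subr_ge0 -mulrzr mulrC -ler_pdivlMr.
have rT : r < T.
  by rewrite ltrBlDr -{1}[T]mulr1 -mulrzr -mulrDr mulrC -ltr_pdivrMr // addrC
     -[1]/(1%:~R) -intrD.
move=> /eqP cr; suff r0' : r = 0 by rewrite r0' add0r.
have [rpi|pir] := leP r pi.
  by apply: cos_inj; rewrite ?cos0 // in_itv/= ?r0 ?rpi ?lexx ?pi_ge0.
have : cos (T - r) = 1 by rewrite -cr -cosN opprB -[in RHS](subrK T r) cosD2pi.
move=> cr'; have /eqP : T - r = 0.
  apply: cos_inj; rewrite ?cos0 // in_itv/= ?lexx ?pi_ge0 // subr_ge0 (ltW rT).
  by rewrite lerBlDr /T mulr2n lerD2l ltW.
by rewrite subr_eq0 => /eqP Tr; rewrite Tr ltxx in rT.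
Qed.

Lemma same_angleP x y : cos x = cos y -> sin x = sin y -> same_angle x y.
Proof.
by move=> ec es; apply: cos_eq1; rewrite cosB ec es -!expr2 cos2Dsin2.
Qed.

Lemma same_angle_refl x : same_angle x x.
Proof. by exists 0; rewrite subrr mulr0z. Qed.

Lemma same_angle_sym x y : same_angle x y -> same_angle y x.
Proof. by case=> n e; exists (- n); rewrite mulrNz -e opprB. Qed.

Lemma same_angle_trans y x z : same_angle x y -> same_angle y z -> same_angle x z.
Proof.
by move=> [n e] [m f]; exists (n + m); rewrite mulrzDr -e -f addrA subrK.
Qed.

Lemma same_angleD x y a b :
  same_angle x y -> same_angle a b -> same_angle (x + a) (y + b).
Proof.
by move=> [n e] [m f]; exists (n + m); rewrite mulrzDr -e -f opprD addrACA.
Qed.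

Lemma same_angleN x y : same_angle x y -> same_angle (- x) (- y).
Proof. by move=> [n e]; exists (- n); rewrite mulrNz -e opprB opprK addrC. Qed.

Lemma same_angleMz x y k : same_angle x y -> same_angle (x *~ k) (y *~ k).
Proof. by move=> [n e]; exists (n * k); rewrite mulrzA -e mulrzBl. Qed.

Definition len (z : R * R) : R := Num.sqrt (z.1 ^+ 2 + z.2 ^+ 2).

Lemma len_sqr z : len z ^+ 2 = z.1 ^+ 2 + z.2 ^+ 2.
Proof. by rewrite sqr_sqrtr // addr_ge0 ?sqr_ge0. Qed.

Lemma len_gt0 (z : R * R) : z <> 0 -> 0 < len z.
Proof.
case: z => u v uv0; rewrite sqrtr_gt0 /= lt0r paddr_eq0 ?sqr_ge0 //.
rewrite !sqrf_eq0 addr_ge0 ?sqr_ge0 // andbT; apply/negP => /andP[/eqP u0 /eqP v0].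
by apply: uv0; rewrite u0 v0.
Qed.

Definition arg (z : R * R) : R :=
  if 0 <= z.2 then acos (z.1 / len z) else - acos (z.1 / len z).

Lemma cos_len_itv (z : R * R) : z <> 0 -> -1 <= z.1 / len z <= 1.
Proof.
move=> /len_gt0 z0; rewrite -ler_norml normrM normfV (gtr0_norm z0).
rewrite ler_pdivrMr // mul1r -(@ler_pXn2r _ 2) ?nnegrE ?normr_ge0 ?(ltW z0) //.
by rewrite len_sqr -normrX ger0_norm ?sqr_ge0 // lerDl sqr_ge0.
Qed.

Lemma cos_arg z : z <> 0 -> cos (arg z) = z.1 / len z.
Proof.
move=> z0; rewrite /arg; have zi := cos_len_itv z0.
by case: ifP => _; rewrite ?cosN acosK ?in_itv.
Qed.

Lemma sin_arg z : z <> 0 -> sin (arg z) = z.2 / len z.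
Proof.
move=> z0; rewrite /arg; have zi := cos_len_itv z0.
have lz := len_gt0 z0.
have s : sin (acos (z.1 / len z)) = `|z.2| / len z.
  rewrite sin_acos // exprMn exprVn len_sqr.
  rewrite (_ : 1 - _ = (`|z.2| / len z) ^+ 2); last first.
    rewrite exprMn exprVn len_sqr -normrX ger0_norm ?sqr_ge0 //.
    by rewrite -len_sqr; field: (len_sqr z); rewrite gt_eqF.
  by rewrite sqrtr_sqr ger0_norm // divr_ge0 // ltW.
have [z2|z2] := leP 0 z.2; first by rewrite s ger0_norm.
by rewrite sinN s ltr0_norm // mulNr opprK.
Qed.

Lemma arg_unique (r : R) x z : 0 < r -> z = (r * cos x, r * sin x) ->
  same_angle (arg z) x.
Proof.
move=> r0 ez; have lz : len z = r.
  by rewrite /len ez/= !exprMn -mulrDr cos2Dsin2 mulr1 sqrtr_sqr gtr0_norm.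
have z0 : z <> 0.
  by move=> z0; move: lz r0; rewrite z0 /len/= expr0n addr0 sqrtr0 => <-; rewrite ltxx.
apply: same_angleP; rewrite ?cos_arg ?sin_arg // lz ez/= mulrC mulKf ?gt_eqF //.
Qed.

Lemma cos_argB_gt0 z w : z <> 0 -> w <> 0 ->
  0 < z.1 * w.1 + z.2 * w.2 -> 0 < cos (arg z - arg w).
Proof.
move=> z0 w0 zw; rewrite cosB !cos_arg // !sin_arg //.
have lz := len_gt0 z0; have lw := len_gt0 w0.
rewrite (_ : _ + _ = (z.1 * w.1 + z.2 * w.2) / (len z * len w)).
  by rewrite divr_gt0 // mulr_gt0.
by field; rewrite !gt_eqF.
Qed.

End Angles.

(** * Continuous determinations of an angle *)

Lemma within_continuous_compose (T U W : topologicalType) (A : set T) (B : set U)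
    (g : T -> U) (f : U -> W) :
  {within A, continuous g} -> (forall x, A x -> B (g x)) ->
  {within B, continuous f} -> {within A, continuous (f \o g)}.
Proof.
move=> /subspace_continuousP cg gAB /subspace_continuousP cf.
apply/subspace_continuousP => x Ax.
have := cf _ (gAB x Ax); apply: cvg_trans => Q /= BQ.
have := cg x Ax _ BQ; rewrite /nbhs /= /within /= => nQ.
by apply: filterS nQ => t h At; exact: (h At (gAB t At)).
Qed.

Section Lifts.
Context {R : realType}.

Section Continuity.
Context {T : topologicalType}.
Implicit Types (X Y : set T) (th ph : T -> R).

Lemma within_continuous_add X (f g : T -> R) : {within X, continuous f} ->
  {within X, continuous g} -> {within X, continuous (fun x => f x + g x)}.
Proof.
by move=> cf cg x; apply: (@continuousD R R (subspace X)); [exact: cf|exact: cg].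
Qed.

Lemma within_continuous_opp X (f : T -> R) : {within X, continuous f} ->
  {within X, continuous (fun x => - f x)}.
Proof. by move=> cf x; apply: (@continuousN R R (subspace X)); exact: cf. Qed.

Lemma within_continuous_mul X (f g : T -> R) : {within X, continuous f} ->
  {within X, continuous g} -> {within X, continuous (fun x => f x * g x)}.
Proof.
by move=> cf cg x; apply: (@continuousM R (subspace X)); [exact: cf|exact: cg].
Qed.

(** A function [th] stands for the circle-valued map with angle [th x] at [x]:
    that map is continuous, while [th] itself may jump by full turns. *)
Definition angle_continuous X th :=
  {within X, continuous (cos \o th)} /\ {within X, continuous (sin \o th)}.

(** This is the lifting property through the covering of the circle by the line. *)
Definition liftable X th := exists2 th' : T -> R,
  {within X, continuous th'} & forall x, X x -> same_angle (th' x) (th x).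

Lemma eq_within_continuous X (f g : T -> R) : (forall x, X x -> f x = g x) ->
  {within X, continuous f} -> {within X, continuous g}.
Proof.
move=> fg; apply: subspace_eq_continuous => x; rewrite inE; exact: fg.
Qed.

Lemma angle_continuous_eq X th ph : (forall x, X x -> same_angle (th x) (ph x)) ->
  angle_continuous X th -> angle_continuous X ph.
Proof.
move=> e [c s]; split.
  by apply: eq_within_continuous c => x /e /same_angle_cos.
by apply: eq_within_continuous s => x /e /same_angle_sin.
Qed.

Lemma continuous_angle X th : {within X, continuous th} -> angle_continuous X th.
Proof.
move=> cth; split=> x; (apply: (@continuous_comp (subspace X)); first exact: cth).
  exact: continuous_cos.
exact: continuous_sin.
Qed.

Lemma angle_continuousS X Y th : X `<=` Y ->
  angle_continuous Y th -> angle_continuous X th.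
Proof. by move=> XY [c s]; split; apply: continuous_subspaceW XY _. Qed.

Lemma angle_continuousD X th ph : angle_continuous X th ->
  angle_continuous X ph -> angle_continuous X (fun x => th x + ph x).
Proof.
move=> [c s] [c' s']; split.
  rewrite (_ : cos \o _ = fun x => cos (th x) * cos (ph x) - sin (th x) * sin (ph x)).
    by apply: within_continuous_add; last apply: within_continuous_opp; apply: within_continuous_mul.
  by apply/funext => x /=; rewrite cosD.
rewrite (_ : sin \o _ = fun x => sin (th x) * cos (ph x) + cos (th x) * sin (ph x)).
  by apply: within_continuous_add; apply: within_continuous_mul.
by apply/funext => x /=; rewrite sinD.
Qed.

Lemma angle_continuousN X th : angle_continuous X th ->
  angle_continuous X (fun x => - th x).
Proof.
move=> [c s]; split.
  by apply: eq_within_continuous c => x _ /=; rewrite cosN.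
rewrite (_ : sin \o _ = fun x => - sin (th x)).
  exact: within_continuous_opp.
by apply/funext => x /=; rewrite sinN.
Qed.

Lemma angle_continuousMz X th (n : int) : angle_continuous X th ->
  angle_continuous X (fun x => th x *~ n).
Proof.
move=> cth; have pos m : angle_continuous X (fun x => th x *+ m).
  elim: m => [|m ih].
    apply: (@angle_continuous_eq _ (fun=> 0)) => [x _|]; first exact: same_angle_refl.
    by apply: continuous_angle => x; exact: cst_continuous.
  apply: angle_continuous_eq (angle_continuousD ih cth) => x _.
  by rewrite -mulrSr; exact: same_angle_refl.
case: n => m; first exact: pos.
exact/angle_continuousN/pos.
Qed.

Lemma liftable_eq X th ph : (forall x, X x -> same_angle (th x) (ph x)) ->
  liftable X th -> liftable X ph.
Proof.
move=> e [f cf ef]; exists f => // x Xx.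
by apply: same_angle_trans (ef _ Xx) (e _ Xx).
Qed.

Lemma liftableS X Y th : X `<=` Y -> liftable Y th -> liftable X th.
Proof.
move=> XY [f cf ef]; exists f; first exact: continuous_subspaceW cf.
by move=> x /XY /ef.
Qed.

Lemma liftableD X th ph : liftable X th -> liftable X ph ->
  liftable X (fun x => th x + ph x).
Proof.
move=> [f cf ef] [g cg eg]; exists (fun x => f x + g x).
  exact: within_continuous_add.
by move=> x Xx; apply: same_angleD; [exact: ef|exact: eg].
Qed.

Lemma liftableN X th : liftable X th -> liftable X (fun x => - th x).
Proof.
move=> [f cf ef]; exists (fun x => - f x).
  exact: within_continuous_opp.
by move=> x Xx; apply: same_angleN; exact: ef.
Qed.

Lemma asin_sin_same_angle (x : R) : 0 < cos x -> same_angle (asin (sin x)) x.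
Proof.
move=> cx; have si : -1 <= sin x <= 1 by rewrite sin_geN1 sin_le1.
apply: same_angleP; last by rewrite asinK.
by rewrite cos_asin // -cos2sin2 sqrtr_sqr gtr0_norm.
Qed.

(** As long as the cosine stays positive, the arcsine of the sine is a
    determination of the angle that requires no choice of a branch. *)
Lemma asin_sin_continuous X th : angle_continuous X th ->
  (forall x, X x -> 0 < cos (th x)) ->
  {within X, continuous (fun x => asin (sin (th x)))}.
Proof.
move=> [c s] pos; apply: (@within_continuous_comp _ _ _ _ (sin \o th) asin) => //.
move=> y; rewrite inE => -[x Xx <-] /=.
apply: continuous_asin; rewrite -ltr_norml -(@expr_lt1 _ 2) //.
by rewrite -normrX ger0_norm ?sqr_ge0 // sin2cos2 ltrBlDr ltrDl exprn_gt0 // pos.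
Qed.

Lemma liftable_acute X th : angle_continuous X th ->
  (forall x, X x -> 0 < cos (th x)) -> liftable X th.
Proof.
move=> c pos; exists (fun x => asin (sin (th x))); first exact: asin_sin_continuous.
by move=> x Xx; apply: asin_sin_same_angle; exact: pos.
Qed.

End Continuity.

Lemma angle_continuous_comp (T U : topologicalType) (A : set T) (B : set U)
    (g : T -> U) (th : U -> R) :
  {within A, continuous g} -> (forall x, A x -> B (g x)) ->
  angle_continuous B th -> angle_continuous A (fun x => th (g x)).
Proof.
move=> cg gAB [c s]; split.
  exact: (@within_continuous_compose _ _ _ A B g (cos \o th)).
exact: (@within_continuous_compose _ _ _ A B g (sin \o th)).
Qed.

Lemma liftable_comp (T U : topologicalType) (A : set T) (B : set U)
    (g : T -> U) (th : U -> R) :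
  {within A, continuous g} -> (forall x, A x -> B (g x)) ->
  liftable B th -> liftable A (fun x => th (g x)).
Proof.
move=> cg gAB [f cf ef]; exists (f \o g); first exact: within_continuous_compose gAB cf.
by move=> x /gAB /ef.
Qed.

Section StarShaped.
Context {V : normedModType R} (X : set V).
Hypothesis X_compact : compact X.
Hypothesis X_star : forall x (t : R), X x -> 0 <= t <= 1 -> X (t *: x).

(** This is uniform continuity on a compact set; it bounds the steps into which
    the segments from the origin are cut below. *)
Lemma angle_uniform (th : V -> R) : angle_continuous X th ->
  exists2 d : R, 0 < d & forall x y, X x -> X y -> `|x - y| < d ->
    0 < cos (th x - th y).
Proof.
move=> [/subspace_continuousP c /subspace_continuousP s].
have /compact_near_coveringP cov := X_compact.
have e8 : 0 < 8^-1 :> R by rewrite invr_gt0.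
pose P d x := X x -> forall y, X y -> `|x - y| < d -> 0 < cos (th x - th y).
have dP : \forall d \near (0 : R)^'+, X `<=` P d.
  apply: cov => x Xx.
  have /cvgrPdist_lt/(_ _ e8) nc := c x Xx.
  have /cvgrPdist_lt/(_ _ e8) ns := s x Xx.
  have /nbhs_ballP[d /= d0 dP] : \forall y \near x, X y ->
      `|cos (th x) - cos (th y)| < 8^-1 /\ `|sin (th x) - sin (th y)| < 8^-1.
    have := nc; have := ns; rewrite /prop_near1 /nbhs /= /within /= => ns' nc'.
    by apply: filterS2 nc' ns' => y h1 h2 Xy; split; [exact: h1|exact: h2].
  exists (ball x (d / 2), [set e | e < d / 2]) => /=.
    split; first by apply: nbhsx_ballx; rewrite divr_gt0.
    by apply: nbhs_right_lt; rewrite divr_gt0.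
  move=> [y e] /= [xy ed] Xy z Xz yz.
  have dd : d / 2 <= d by rewrite ler_pdivrMr // ler_peMr ?ltW // ltr1n.
  have [cy sy] := dP y (le_ball dd xy) Xy.
  have xz : ball x d z.
    rewrite [d]splitr; apply: ball_triangle xy _.
    by rewrite -ball_normE /= (lt_trans yz).
  have [cz sz] := dP z xz Xz.
  have sq (u v w : R) : `|u - v| < 8^-1 -> `|u - w| < 8^-1 -> (v - w) ^+ 2 <= 16^-1.
    rewrite !ltr_norml => /andP[? ?] /andP[? ?].
    have h1 : v - w <= 4^-1 by lra.
    have h2 : - 4^-1 <= v - w by lra.
    by nra.
  have := sq _ _ _ cy cz; have := sq _ _ _ sy sz.
  rewrite cosB; have := cos2Dsin2 (th y); have := cos2Dsin2 (th z).
  by nra.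
have : \forall e \near (0:R)^'+, 0 < e /\ X `<=` P e.
  by near=> e; split; near: e; [exact: nbhs_right_gt|exact: dP].
move=> /filter_ex[e [e0 eP]]; exists e => // x y Xx Xy xy; exact: eP.
Unshelve. all: by end_near.
Qed.

(** Cut the segment from 0 to [x] into [N] equal steps. By uniform continuity the
    angles at consecutive points differ by less than a quarter turn when [N] is
    large, so each step has a determination, and the steps telescope. *)
Lemma star_liftable (th : V -> R) : angle_continuous X th -> liftable X th.
Proof.
move=> cth; have [d d0 dP] := angle_uniform cth.
have [B [_ /(_ (B + 1))]] := compact_bounded X_compact.
rewrite ltrDl ltr01 => /(_ isT) BP.
have [N N0 NP] : exists2 N : nat, (0 < N)%N & forall x, X x -> `|x| < d * N%:R.
  exists (Num.bound (`|B + 1| / d)).+1 => // x /BP xB.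
  rewrite -ltr_pdivrMl // mulrC.
  have := archi_boundP (divr_ge0 (normr_ge0 (B + 1)) (ltW d0)).
  move=> lt; apply: (@le_lt_trans _ _ (`|B + 1| / d)); last first.
    by apply: (lt_trans lt); rewrite ltr_nat.
  by rewrite ler_wpM2r ?invr_ge0 ?(ltW d0) // (le_trans xB) // ler_norm.
have N0' : 0 < N%:R :> R by rewrite ltr0n.
pose s (i : nat) : R := i%:R / N%:R.
have sX i x : (i <= N)%N -> X x -> X (s i *: x).
  move=> iN Xx; apply: X_star => //; rewrite divr_ge0 //= ler_pdivrMr // mul1r.
  by rewrite ler_nat.
have scX i : (i <= N)%N -> angle_continuous X (fun x => th (s i *: x)).
  move=> iN; have cs : {within X, continuous (fun x : V => s i *: x)}.
    by apply: continuous_subspaceT; exact: scaler_continuous.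
  by apply: (angle_continuous_comp cs _ cth) => x; exact: sX.
have : forall n, (n <= N)%N -> liftable X (fun x => th (s n *: x) - th (s 0%N *: x)).
  elim => [_|n ih nN].
    exists (fun=> 0) => [x|x Xx]; first exact: cst_continuous.
    by rewrite subrr; exact: same_angle_refl.
  have step : liftable X (fun x => th (s n.+1 *: x) - th (s n *: x)).
    apply: liftable_acute.
      by apply: angle_continuousD; [exact: scX|apply/angle_continuousN/scX/ltnW].
    move=> x Xx; apply: dP; [exact: sX|apply: sX => //; exact: ltnW|].
    rewrite -scalerBl -mulrBl -natrB // subSnn normrZ ger0_norm ?divr_ge0 //.
    by rewrite mul1r mulrC ltr_pdivrMr // NP.
  apply: liftable_eq (liftableD step (ih (ltnW nN))) => x Xx.
  by rewrite addrA subrK; exact: same_angle_refl.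
move=> /(_ N (leqnn _)) lN.
have l0 : liftable X (fun x => th (s 0%N *: x)).
  exists (fun=> th 0) => [x|x Xx]; first exact: cst_continuous.
  by rewrite /s mul0r scale0r; exact: same_angle_refl.
apply: liftable_eq (liftableD lN l0) => x Xx.
by rewrite subrK /s divff ?scale1r ?gt_eqF //; exact: same_angle_refl.
Qed.
End StarShaped.
End Lifts.

(** * Polar angles in the plane *)

Section Plane.
Context {R : realType}.
Implicit Types (p q z w : R * R) (X K A : set (R * R)).

(** The image is an interval within the discrete set of multiples of a full turn. *)
Lemma connected_same_angle (T : topologicalType) (D : set T) (f : T -> R) :
  connected D -> {within D, continuous f} ->
  (forall x, D x -> same_angle (f x) 0) ->
  forall x y, D x -> D y -> f x = f y.
Proof.
move=> cD cf f0.
have /connected_intervalP itv := connected_continuous_connected cD cf.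
suff H : forall x y, D x -> D y -> ~ f x < f y.
  by move=> x y Dx Dy; apply/eqP; case: ltgtP => // fxy; exfalso; apply: H fxy.
(* [w] is a value of [f], above [f x] by at most half a turn *)
move=> x y Dx Dy fxy; set w := Num.min (f x + pi) (f y).
have xw : f x < w by rewrite lt_min fxy ltrDl pi_gt0.
have wy : w <= f y by rewrite ge_min lexx orbT.
have wx : w <= f x + pi by rewrite ge_min lexx.
have [z Dz fz] : (f @` D) w.
  by apply: (itv (f x) (f y)); [exists x|exists y|rewrite (ltW xw) wy].
have : cos (w - f x) = 1.
  rewrite -fz -cos0; apply: same_angle_cos.
  rewrite -[0]subr0; apply: same_angleD; [exact: f0|apply: same_angleN; exact: f0].
rewrite -cos0 => /cos_inj; rewrite !in_itv/= lexx pi_ge0 subr_ge0 (ltW xw).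
rewrite lerBlDl wx => /(_ isT isT)/eqP; rewrite subr_eq0 => /eqP wfx.
by rewrite wfx ltxx in xw.
Qed.

Lemma len_continuous : continuous (@len R).
Proof.
move=> z; apply: (@continuous_comp (R * R)%type R R _ Num.sqrt); last exact: sqrt_continuous.
by apply: continuousD; apply: (@continuous_comp (R * R)%type R R _ (fun x : R => x ^+ 2));
  [exact: cvg_fst | exact: exprn_continuous|exact: cvg_snd|exact: exprn_continuous].
Qed.

Lemma arg_continuous p : angle_continuous (~` [set p]) (fun z => arg (z - p)).
Proof.
have d_cont : continuous (fun z : R * R => z - p).
  by move=> z; apply: continuousB; [exact: cvg_id|exact: cst_continuous].
have main (g : R * R -> R) : continuous g ->
   {within (~` [set p]), continuous (fun z => g (z - p) / len (z - p))}.
  move=> cg; apply: continuous_in_subspaceT => z; rewrite inE /= => zp.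
  have lz : len (z - p) != 0 by rewrite gt_eqF // len_gt0 // => /eqP; rewrite subr_eq0 => /eqP.
  apply: cvgM.
    by apply: (continuous_comp (d_cont z)); exact: cg.
  apply: cvgV => //.
  by apply: (continuous_comp (d_cont z)); exact: len_continuous.
have nz z : (~` [set p]) z -> z - p <> 0 by move=> zp /eqP; rewrite subr_eq0 => /eqP.
split.
  apply: eq_within_continuous (main fst _).
    by move=> z zp /=; rewrite cos_arg //; exact: nz.
  by move=> z; exact: cvg_fst.
apply: eq_within_continuous (main snd _).
  by move=> z zp /=; rewrite sin_arg //; exact: nz.
by move=> z; exact: cvg_snd.
Qed.

Definition circle p (r : R) : set (R * R) :=
  range (fun t => (p.1 + r * cos t, p.2 + r * sin t)).

(** A determination of [n] times the angle grows by [n] full turns along the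
    circle, but takes the same value at both ends of the turn. *)
Lemma circle_not_liftable p (r : R) (n : int) : 0 < r ->
  liftable (circle p r) (fun z => arg (z - p) *~ n) -> n = 0.
Proof.
move=> r0 [f cf fP]; pose c t := (p.1 + r * cos t, p.2 + r * sin t).
have c1 (g : R -> R) u t : continuous g -> u + r * g s @[s --> t] --> u + r * g t.
  by move=> cg; apply: cvgD; [exact: cvg_cst|apply: cvgM; [exact: cvg_cst|exact: cg]].
have cc : continuous c.
  move=> t; exact: cvg_pair (c1 _ p.1 t (@continuous_cos R)) (c1 _ p.2 t (@continuous_sin R)).
pose h t := f (c t) - t *~ n.
have ch : {within setT, continuous h}.
  apply: within_continuous_add.
    apply: (@within_continuous_compose _ _ _ _ (circle p r) c f) => //.
      exact: continuous_subspaceT.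
    by move=> t _; exists t.
  apply: within_continuous_opp; rewrite (_ : (fun x => x *~ n) = (fun x => x * n%:~R)).
    by apply: continuous_subspaceT => x; apply: cvgM; [exact: cvg_id|exact: cvg_cst].
  by apply/funext => x; rewrite mulrzr.
have h0 t : same_angle (h t) 0.
  rewrite -(subrr (t *~ n)); apply: same_angleD; last exact: same_angle_refl.
  apply: same_angle_trans (fP _ _) _; first by exists t.
  apply: same_angleMz; apply: arg_unique r0 _.
  by rewrite /c; congr pair; rewrite /= addrC addKr.
have cR : connected [set: R] by apply/connected_intervalP.
have := connected_same_angle cR ch (fun t _ => h0 t) (x := 0) (y := pi *+ 2) I I.
rewrite /h /c cos2pi sin2pi cos0 sin0 mul0rz subr0 => /eqP.
rewrite -subr_eq0 opprB addrC subrK mulrz_eq0 => /orP[/eqP//|].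
by rewrite mulrn_eq0 /= gt_eqF // pi_gt0.
Qed.

(** For a compact set this says that its first integral cohomology vanishes, as
    the latter classifies circle-valued maps up to liftable ones. *)
Definition angle_acyclic A := compact A /\
  forall th : R * R -> R, angle_continuous A th -> liftable A th.

Lemma itv_liftable (a b : R) (th : R -> R) : a <= b ->
  angle_continuous `[a, b] th -> liftable `[a, b] th.
Proof.
move=> ab cth.
have ca (u : R) (X : set R) : {within X, continuous (fun t : R => t + u)}.
  by apply: continuous_subspaceT => x; apply: cvgD; [exact: cvg_id|exact: cvg_cst].
have : liftable `[0, b - a] (fun t => th (t + a)).
  apply: (@star_liftable R R) => [|x t|].
  - exact: segment_compact.
  - rewrite /= !in_itv/= => /andP[x0 xb] /andP[t0 t1]; rewrite mulr_ge0 //=.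
    by apply: le_trans xb; rewrite ler_piMl.
  - apply: angle_continuous_comp (ca a _) _ cth => x /=; rewrite !in_itv/=.
    by move=> /andP[? ?]; apply/andP; split; lra.
move=> l; rewrite (_ : th = fun t => th (t - a + a)); last first.
  by apply/funext => t; rewrite subrK.
apply: (@liftable_comp _ _ _ `[a, b] `[0, b - a] (fun t => t - a) _ _ _ l).
  exact: ca.
by move=> x /=; rewrite !in_itv/= => /andP[? ?]; apply/andP; split; lra.
Qed.

(** A continuous injection of a segment is a closed map, so the parameter is a
    continuous function of the point and a determination over the segment can
    be carried to the arc. *)
Lemma arc_acyclic (g : R -> R * R) (a b : R) : a <= b ->
  {within `[a, b], continuous g} ->
  (forall s t, a <= s <= b -> a <= t <= b -> g s = g t -> s = t) ->
  angle_acyclic (g @` `[a, b]).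
Proof.
move=> ab cg inj_g; split.
  by apply: continuous_compact => //; exact: segment_compact.
move=> th cth.
have [f cf fP] : liftable `[a, b] (fun t => th (g t)).
  apply: itv_liftable => //; apply: angle_continuous_comp cg _ cth.
  by move=> t tab; exists t.
pose ginv z := xget 0 [set t | `[a, b] t /\ g t = z].
have gK t : `[a, b] t -> ginv (g t) = t.
  move=> tab; rewrite /ginv; case: xgetP => [s -> [sab gs]|/(_ t)].
    by move: sab tab; rewrite /= !in_itv /= => sab tab; exact: inj_g gs.
  by case.
exists (f \o ginv); last first.
  by move=> _ [t tab <-] /=; rewrite gK //; exact: fP.
apply/continuous_closedP => C cC; apply/closed_subspaceP.
move/continuous_closedP: cf => /(_ C cC)/closed_subspaceP[W cW WC].
exists (g @` (W `&` `[a, b])).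
  apply: compact_closed; first exact: norm_hausdorff.
  apply: continuous_compact.
    by apply: continuous_subspaceW cg => x [].
  by rewrite setIC; apply: compact_closedI => //; exact: segment_compact.
rewrite WC; apply/seteqP; split=> z.
  by move=> [[t [Ct tab] <-] _]; split; [rewrite /from_subspace /= gK|exists t].
move=> [/= Cz [t tab tz]]; split; last by exists t.
by exists t => //; split=> //=; rewrite /from_subspace -(gK t) // tz.
Qed.

End Plane.

(** * Connected sets and components *)

Section ConnectedSets.
Context {R : realType}.

Lemma segment_path_connected (V : normedModType R) (x y : V) :
  connected ((fun t : R => x + t *: (y - x)) @` `[0, 1]).
Proof.
apply: connected_continuous_connected; first exact: segment_connected.
apply: continuous_subspaceT => t; apply: cvgD; first exact: cvg_cst.
by apply: cvgZr_tmp; exact: cvg_id.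
Qed.

Lemma convex_connected (V : normedModType R) (X : set V) :
  (forall x y (t : R), X x -> X y -> 0 <= t <= 1 -> X (x + t *: (y - x))) ->
  connected X.
Proof.
move=> cvx; have [X0|/nonemptyPn ->] := pselect (X !=set0); last exact: connected0.
case: X0 => x Xx.
rewrite (_ : X = \bigcup_(y in X) ((fun t : R => x + t *: (y - x)) @` `[0, 1])).
  apply: bigcup_connected; last by move=> y _; exact: segment_path_connected.
  exists x => y Xy; exists 0; first by rewrite /= in_itv/= lexx ler01.
  by rewrite scale0r addr0.
apply/seteqP; split => [y Xy|y [w Xw [t]]].
  exists y => //; exists 1; first by rewrite /= in_itv/= lexx ler01.
  by rewrite scale1r addrC subrK.
by rewrite /= in_itv/= => t01 <-; exact: cvx.
Qed.

Lemma ball_connected (V : normedModType R) (x : V) e : connected (ball x e).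
Proof.
apply: convex_connected => y z t; rewrite -ball_normE /= => xy xz /andP[t0 t1].
rewrite (_ : x - _ = (1 - t) *: (x - y) + t *: (x - z)); last first.
  have -> : z - y = (x - y) - (x - z) by rewrite opprB [RHS]addrC addrA subrK.
  by rewrite opprD addrA scalerBr scalerBl scale1r opprB addrA addrAC.
apply: (le_lt_trans (ler_normD _ _)); rewrite !normrZ !ger0_norm ?subr_ge0 //.
have [->|t0'] := eqVneq t 0; first by rewrite subr0 mul1r mul0r addr0.
apply: (@lt_le_trans _ _ ((1 - t) * e + t * e)); last by rewrite -mulrDl subrK mul1r.
by rewrite ler_ltD // ?ler_wpM2l ?subr_ge0 ?(ltW xy) // ltr_pM2l // lt0r t0'.
Qed.

Lemma component_open (V : normedModType R) (A : set V) x :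
  open A -> open (connected_component A x).
Proof.
move=> oA; rewrite openE => y xy.
have Ay : A y by apply: connected_component_sub xy.
have /nbhs_ballP[e /= e0 eA] : nbhs y A by exact: open_nbhs_nbhs.
apply/nbhs_ballP; exists e => //= z yz; apply: connected_component_trans xy _.
by exists (ball y e) => //; split=> //; [exact: ballxx|exact: ball_connected].
Qed.

(** A point off [K] has its own component as a neighbourhood, so it can only be
    adherent to that one. *)
Lemma closure_component (V : normedModType R) (K : set V) x : closed K ->
  closure (connected_component (~` K) x) `<=` connected_component (~` K) x `|` K.
Proof.
move=> cK z Uz; have [Kz|Kz] := pselect (K z); first by right.
left; have oK : open (~` K) by exact: closed_openC.
have [|w [xw zw]] := Uz (connected_component (~` K) z).
  apply: open_nbhs_nbhs; split; first exact: component_open.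
  exact: connected_component_refl.
by apply: connected_component_trans xw _; exact: connected_component_sym.
Qed.

End ConnectedSets.

(** * Poles and the components of a complement *)

Section OnePole.
Context {R : realType}.
Implicit Types (p q z w : R * R) (X K A : set (R * R)).

Definition component K p := connected_component (~` K) p.

Lemma norm_pair z : `|z| = Num.max `|z.1| `|z.2|.
Proof. by []. Qed.

Lemma norm_pair_le z (C : R) : (`|z| <= C) = (`|z.1| <= C) && (`|z.2| <= C).
Proof. by rewrite norm_pair ge_max. Qed.

Lemma norm_pair_lt z (C : R) : (`|z| < C) = (`|z.1| < C) && (`|z.2| < C).
Proof. by rewrite norm_pair gt_max. Qed.

Lemma closed_ball0_compact (C : R) : compact [set z : R * R | `|z| <= C].
Proof.
rewrite (_ : [set _ | _] = `[-C, C]%classic `*` `[-C, C]%classic).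
  by apply: compact_setX; exact: segment_compact.
by apply/seteqP; split=> -[u v]; rewrite /= !in_itv/= norm_pair_le /= -!ler_norml => /andP.
Qed.

Lemma angle_continuousU (T : topologicalType) (X Y : set T) (th : T -> R) :
  closed X -> closed Y -> angle_continuous X th -> angle_continuous Y th ->
  angle_continuous (X `|` Y) th.
Proof. by move=> cX cY [c s] [c' s']; split; apply: withinU_continuous. Qed.

(** Inside the component of [p] replace the angle [n * arg (z - p)] by a Tietze
    extension of the determination given on [K], corrected by [Phi]; outside keep
    it. The pole has disappeared, so the new angle is continuous on the whole
    plane and liftable on a large square, although on a large circle it is still
    [n] times the angle seen from [p]. *)
Lemma bounded_component_rigid K p (n : int) (Phi : R * R -> R) :
  compact K -> ~ K p -> (exists B, component K p `<=` [set z | `|z| <= B]) ->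
  angle_continuous (closure (component K p)) Phi ->
  liftable K (fun z => arg (z - p) *~ n + Phi z) -> n = 0.
Proof.
move=> cK Kp [B UB] cPhi [al cal alP].
have clK : closed K by apply: compact_closed => //; exact: norm_hausdorff.
set U := component K p in UB cPhi *.
have oU : open U by apply: component_open; exact: closed_openC.
have Up : U p by exact: connected_component_refl.
have [M M0 alM] : exists2 M : R, 0 < M & forall z, K z -> `|al z| <= M.
  have : compact (al @` K) by exact: continuous_compact.
  move=> /(@compact_bounded R R)[M [_ /(_ (`|M| + 1))]].
  rewrite (@le_lt_trans _ _ `|M|) ?ler_norm ?ltrDl // => /(_ isT) alM.
  exists (`|M| + 1); first by rewrite ltr_wpDl.
  by move=> z Kz; apply: alM; exists z.
have [be [al_be cbe _]] := continuous_bounded_extension pseudometric_normal clK M0 cal alM.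
pose H z : R := if pselect (U z) then (be z : R) - Phi z else arg (z - p) *~ n.
have cH1 : angle_continuous (closure U) H.
  apply: (@angle_continuous_eq _ _ _ (fun z => be z - Phi z)); last first.
    apply: angle_continuousD; last exact: angle_continuousN.
    by apply: continuous_angle; exact: continuous_subspaceT.
  move=> z Uz; rewrite /H; case: pselect => [Uz'|nUz] /=; first exact: same_angle_refl.
  have Kz : K z by have [] := closure_component clK Uz.
  rewrite -(al_be z) ?inE // -[_ *~ n](addrK (Phi z)).
  by apply: same_angleD; [exact: alP|exact: same_angle_refl].
have cH2 : angle_continuous (~` U) H.
  apply: (@angle_continuous_eq _ _ _ (fun z => arg (z - p) *~ n)).
    by move=> z Uz; rewrite /H; case: pselect => //= Uz'; exact: same_angle_refl.
  apply: angle_continuousMz; apply: angle_continuousS (arg_continuous p).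
  by move=> z Uz zp; apply: Uz; rewrite zp.
have cH : angle_continuous setT H.
  apply: angle_continuousS (angle_continuousU _ _ cH1 cH2).
  - by move=> z _; have [Uz|Uz] := pselect (U z); [left; exact: subset_closure|right].
  - exact: closed_closure.
  - exact: open_closedC.
(* [r] exceeds the distance from [p] to the points of its component *)
pose C : R := `|B| + `|p|; have C0 : 0 <= C by rewrite addr_ge0.
pose r := 2 * (C + 1); have r0 : 0 < r by rewrite /r; lra.
have lH : liftable [set z : R * R | `|z| <= `|p| + r] H.
  apply: (@star_liftable R (R * R)%type).
  - exact: closed_ball0_compact.
  - move=> x t /= xp /andP[t0 t1]; rewrite normrZ ger0_norm //.
    by apply: le_trans xp; rewrite ler_piMl.
  - exact: angle_continuousS cH.
apply: (@circle_not_liftable _ p r n r0).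
have cU z : circle p r z -> ~ U z.
  move=> [t _ <-] /UB /=; rewrite norm_pair_le /= => /andP[b1 b2].
  have : `|p| <= `|p| by [].
  rewrite {1}norm_pair ge_max => /andP[p1 p2].
  have B0 := ler_norm B.
  have := cos2Dsin2 t.
  move: b1 b2 p1 p2; rewrite !ler_norml => /andP[? ?] /andP[? ?] /andP[? ?] /andP[? ?] cs.
  have h1 : - C <= r * cos t <= C by rewrite /C; apply/andP; split; lra.
  have h2 : - C <= r * sin t <= C by rewrite /C; apply/andP; split; lra.
  have h3 : (r * cos t) ^+ 2 + (r * sin t) ^+ 2 = r ^+ 2.
    by rewrite !exprMn -mulrDr cs mulr1.
  move: h1 h2 h3; rewrite [in X in _ = X]/r.
  move: (r * cos t) (r * sin t) (C) C0 => a b c c0 /andP[? ?] /andP[? ?].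
  have a2 : a ^+ 2 <= c ^+ 2 by nra.
  have b2 : b ^+ 2 <= c ^+ 2 by nra.
  by nra.
apply: liftable_eq (liftableS _ lH).
  by move=> z /cU Uz; rewrite /H; case: pselect => //= Uz'; exact: same_angle_refl.
move=> z [t _ <-] /=; rewrite norm_pair_le /=.
have : `|p| <= `|p| by [].
rewrite {1}norm_pair ge_max => /andP[p1 p2].
have tr x y : `|x| <= `|p| -> `|y| <= 1 -> `|x + r * y| <= `|p| + r.
  move=> xp y1; rewrite (le_trans (ler_normD _ _)) // lerD // normrM gtr0_norm //.
  by rewrite ler_piMr // ltW.
by rewrite !tr ?cos_max ?sin_max.
Qed.

(** The coordinate of [a] that realizes the maximum norm contributes more to the
    scalar product than the other one can take away. *)
Lemma acute_perturb (a d : R * R) : a <> 0 -> `|d| < `|a| / 2 ->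
  0 < a.1 * (a - d).1 + a.2 * (a - d).2.
Proof.
move=> a0 da; have {}a0 : 0 < `|a| by rewrite normr_gt0; apply/eqP.
move: da; rewrite norm_pair_lt => /andP[]; rewrite !ltr_norml.
move=> /andP[? ?] /andP[? ?] /=.
have key (m u v d1 d2 : R) : 0 < m -> m <= `|u| -> - (m / 2) < d1 -> d1 < m / 2 ->
    - (m / 2) < d2 -> d2 < m / 2 -> 0 < u * (u - d1) + v * (v - d2).
  move=> m0 mu ? ? ? ?.
  have h1 : m ^+ 2 / 2 <= u * (u - d1).
    by move: mu; rewrite ler_normr => /orP[?|?]; nra.
  have h2 : d2 ^+ 2 <= m ^+ 2 / 4 by nra.
  have h3 : 0 <= (v - d2 / 2) ^+ 2 by exact: sqr_ge0.
  by nra.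
have : (`|a| <= `|a.1|) || (`|a| <= `|a.2|) by rewrite -le_max.
case/orP => h; first exact: (key `|a|).
by rewrite addrC; exact: (key `|a|).
Qed.

Lemma acute_arg (u v : R * R) : u <> 0 -> `|u - v| < `|u| / 2 ->
  0 < cos (arg u - arg v).
Proof.
move=> u0 uv; apply: cos_argB_gt0 => //; last first.
  by have := acute_perturb u0 uv; rewrite opprB (addrC u) subrK.
move=> v0; have : 0 < `|u| by rewrite normr_gt0; apply/eqP.
by move: uv; rewrite v0 subr0; lra.
Qed.

(** The points [q] for which the lift exists form an open and closed set: moving
    a pole by less than half its distance to [K] turns the directions to the
    points of [K] by less than a quarter turn. *)
Lemma component_liftable K p q : closed K -> component K p q ->
  liftable K (fun z => arg (z - p) - arg (z - q)).
Proof.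
move=> cK pq.
have Kp : ~ K p.
  by move=> Kp; move: pq; rewrite /component connected_component_out //; exact.
pose L q := liftable K (fun z => arg (z - p) - arg (z - q)).
have oK : open (~` K) by exact: closed_openC.
have loc q1 : ~ K q1 -> \forall q2 \near q1, ~ K q2 /\
    liftable K (fun z => arg (z - q1) - arg (z - q2)).
  move=> Kq1; have /nbhs_ballP[e /= e0 eK] : nbhs q1 (~` K) by exact: open_nbhs_nbhs.
  apply/nbhs_ballP; exists (e / 2); rewrite /= ?divr_gt0 // => q2 q12.
  have ee : e / 2 <= e by lra.
  split; first by apply: eK; exact: le_ball q12.
  apply: liftable_acute.
    apply: angle_continuousD; last apply: angle_continuousN.
      by apply: angle_continuousS (arg_continuous q1) => z Kz zq; apply: Kq1; rewrite -zq.
    apply: angle_continuousS (arg_continuous q2) => z Kz zq.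
    by apply: (eK q2 (le_ball ee q12)); rewrite -zq.
  move=> z Kz; apply: acute_arg.
    by move=> /eqP; rewrite subr_eq0 => /eqP zq; apply: Kq1; rewrite -zq.
  rewrite opprB addrC addrA subrK distrC.
  apply: (@lt_le_trans _ _ (e / 2)).
    by move: q12; rewrite -ball_normE.
  rewrite ler_pM2r ?invr_gt0 // leNgt; apply/negP => zq; apply: (eK z) => //.
  by rewrite -ball_normE /= distrC.
pose O1 := [set q | ~ K q /\ L q]; pose O2 := [set q | ~ K q /\ ~ L q].
have Ltrans q1 q2 : L q1 -> liftable K (fun z => arg (z - q1) - arg (z - q2)) -> L q2.
  move=> l1 l2; apply: liftable_eq (liftableD l1 l2) => z _.
  by rewrite addrA subrK; exact: same_angle_refl.
have oO1 : open O1.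
  rewrite openE => q1 [Kq1 Lq1]; apply: filterS (loc _ Kq1) => q2 [Kq2 l].
  by split=> //; exact: Ltrans l.
have oO2 : open O2.
  rewrite openE => q1 [Kq1 Lq1]; apply: filterS (loc _ Kq1) => q2 [Kq2 l].
  split=> // Lq2; apply: Lq1; apply: Ltrans Lq2 _.
  by apply: liftable_eq (liftableN l) => z _; rewrite opprB; exact: same_angle_refl.
have cU : connected (component K p) by exact: component_connected.
have UK : component K p `<=` ~` K by exact: connected_component_sub.
suff UO : component K p `&` O1 = component K p.
  by move: pq; rewrite -UO => -[_ []].
apply: cU.
- exists p; split; first exact: connected_component_refl.
  split=> //; exists (fun=> 0) => [x|z Kz]; first exact: cst_continuous.
  by rewrite subrr; exact: same_angle_refl.
- by exists O1.
- exists (~` O2); first exact: open_closedC.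
  apply/seteqP; split => z [Uz]; first by move=> [_ Lz]; split=> // -[].
  move=> O2z; split=> //; split; first exact: UK.
  by apply: contrapT => Lz; apply: O2z; split=> //; exact: UK.
Qed.

End OnePole.

Section Poles.
Context {R : realType}.
Implicit Types (p q z w : R * R) (X K A : set (R * R)).

Lemma half_plane_connected (c : R) (b s : bool) :
  connected [set z : R * R | c < (-1) ^+ s * (if b then z.1 else z.2)].
Proof.
apply: convex_connected => x y t /= cx cy /andP[t0 t1].
pose f z : R := (-1) ^+ s * (if b then z.1 else z.2).
have -> : (-1) ^+ s * (if b then x.1 + t *: (y.1 - x.1) else x.2 + t *: (y.2 - x.2))
    = (1 - t) * f x + t * f y.
  by rewrite /f; case: b {f cx cy}; rewrite -[t *: _]/(t * _); ring.
have {}cx : c < f x by []. have {}cy : c < f y by [].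
have [->|t0'] := eqVneq t 0; first by rewrite subr0 mul1r mul0r addr0.
have t0'' : 0 < t by rewrite lt0r t0'.
by nra.
Qed.

(** The outside of a square is a chain of four overlapping half-planes. *)
Lemma outside_connected (c : R) : 0 <= c -> connected [set z : R * R | c < `|z|].
Proof.
move=> c0; pose H (b s : bool) := [set z : R * R | c < (-1) ^+ s * (if b then z.1 else z.2)].
rewrite (_ : [set _ | _] =
    ((H true false `|` H false false) `|` H true true) `|` H false true); last first.
  apply/seteqP; split=> z; rewrite /H /= !expr0 !expr1 !mul1r !mulN1r norm_pair lt_max !ltr_normr.
    case/orP => /orP[] ->; by [left; left; left|left; right|left;left;right|right].
  by move=> [[[]|]|] ->; rewrite ?orbT.
have cH b s : connected (H b s) by exact: half_plane_connected.
have d0 : c < c + 1 by rewrite ltrDl.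
apply: connectedU (cH _ _); last apply: connectedU (cH _ _); last apply: connectedU (cH _ _) (cH _ _).
- exists (- (c + 1), - (c + 1)); split; last by rewrite /H /= expr1 mulN1r opprK.
  by right; rewrite /H /= expr1 mulN1r opprK.
- exists (- (c + 1), c + 1); split; last by rewrite /H /= expr1 mulN1r opprK.
  by right; rewrite /H /= expr0 mul1r.
- by exists (c + 1, c + 1); rewrite /H /= expr0 mul1r.
Qed.

Definition bounded_component K p :=
  exists B, component K p `<=` [set z | `|z| <= B].

Lemma unbounded_components K p q : compact K ->
  ~ bounded_component K p ->
  ~ bounded_component K q -> component K p q.
Proof.
move=> cK up uq; have [M [_ /(_ (`|M| + 1))]] := compact_bounded cK.
rewrite (@le_lt_trans _ _ `|M|) ?ler_norm ?ltrDl // => /(_ isT) KM.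
set c := `|M| + 1 in KM; have c0 : 0 <= c by rewrite addr_ge0.
have out r : ~ bounded_component K r ->
    exists2 z, component K r z & c < `|z|.
  move=> ur; apply: contrapT => no; apply: ur; exists c => z Uz /=.
  by rewrite leNgt; apply/negP => cz; apply: no; exists z.
have [z pz cz] := out p up; have [w qw cw] := out q uq.
apply: connected_component_trans pz _.
apply: connected_component_trans (connected_component_sym qw).
exists [set z : R * R | c < `|z|] => //; split=> //.
  by move=> x /= cx /KM /=; rewrite leNgt cx.
exact: outside_connected.
Qed.


Lemma component_sym K p q : component K p q -> component K q p.
Proof. exact: connected_component_sym. Qed.

Lemma component_trans K p q r : component K p q -> component K q r ->
  component K p r.
Proof. exact: connected_component_trans. Qed.

(** The other two poles are harmless since they are not adherent to the component
    of [p]. *)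
Lemma bounded_pole_rigid K p q r (n1 n2 n3 : int) : compact K ->
  ~ K p -> ~ K q -> ~ K r -> bounded_component K p ->
  ~ component K p q -> ~ component K p r ->
  liftable K (fun z => arg (z - p) *~ n1 + (arg (z - q) *~ n2 + arg (z - r) *~ n3)) ->
  n1 = 0.
Proof.
move=> cK Kp Kq Kr bp pq pr.
have cK' : closed K by apply: compact_closed => //; exact: norm_hausdorff.
apply: bounded_component_rigid => //.
have ac s : ~ K s -> ~ component K p s ->
    angle_continuous (closure (component K p)) (fun z => arg (z - s)).
  move=> Ks ps; apply: angle_continuousS (arg_continuous s) => z Uz zs.
  by case: (closure_component cK' Uz); rewrite zs.
by apply: angle_continuousD; apply: angle_continuousMz; exact: ac.
Qed.

(** At most one of the three components is unbounded, and the multiplicity of a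
    pole in a bounded component must vanish. *)
Lemma three_poles_rigid K p q r (n1 n2 n3 : int) : compact K ->
  ~ K p -> ~ K q -> ~ K r ->
  ~ component K p q -> ~ component K p r -> ~ component K q r ->
  liftable K (fun z => arg (z - p) *~ n1 + (arg (z - q) *~ n2 + arg (z - r) *~ n3)) ->
  [\/ n1 = 0 /\ n2 = 0, n1 = 0 /\ n3 = 0 | n2 = 0 /\ n3 = 0].
Proof.
move=> cK Kp Kq Kr pq pr qr l.
have nsym s t : ~ component K s t -> ~ component K t s.
  by move=> st ts; apply/st/component_sym.
have h1 : bounded_component K p -> n1 = 0.
  by move=> bp; exact: (bounded_pole_rigid cK Kp Kq Kr bp pq pr l).
have h2 : bounded_component K q -> n2 = 0.
  move=> bq; apply: (bounded_pole_rigid cK Kq Kp Kr bq (nsym _ _ pq) qr (n2 := n1) (n3 := n3)).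
  by apply: liftable_eq l => z _; rewrite addrCA; exact: same_angle_refl.
have h3 : bounded_component K r -> n3 = 0.
  move=> br; apply: (bounded_pole_rigid cK Kr Kp Kq br (nsym _ _ pr) (nsym _ _ qr) (n2 := n1) (n3 := n2)).
  apply: liftable_eq l => z _; rewrite addrA addrC; exact: same_angle_refl.
have [/h1 n10|up] := pselect (bounded_component K p); last first.
  have bq : bounded_component K q.
    by apply: contrapT => uq; apply: pq; exact: unbounded_components.
  have br : bounded_component K r.
    by apply: contrapT => ur; apply: pr; exact: unbounded_components.
  by apply: Or33; rewrite h2 // h3.
have [/h2 n20|uq] := pselect (bounded_component K q); first exact: Or31.
apply: Or32; rewrite h3 //.
by apply: contrapT => ur; apply: qr; exact: unbounded_components.
Qed.

(** With [component_liftable] this characterizes the components of the complement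
    of [K] by functions on [K] alone, where arcs can be glued one by one. *)
Lemma two_poles_component K p q : compact K -> ~ K p -> ~ K q ->
  liftable K (fun z => arg (z - p) - arg (z - q)) -> component K p q.
Proof.
move=> cK Kp Kq l; apply: contrapT => pq.
have qp : ~ component K q p by move=> /component_sym.
have [bp|up] := pselect (bounded_component K p).
  suff : 1%:Z = 0 by [].
  apply: (bounded_pole_rigid cK Kp Kq Kq bp pq pq (n2 := -1) (n3 := 0)).
  by apply: liftable_eq l => z _; rewrite mulrNz mulr0z addr0; exact: same_angle_refl.
have [bq|uq] := pselect (bounded_component K q).
  suff : -1%:Z = 0 by [].
  apply: (bounded_pole_rigid cK Kq Kp Kp bq qp qp (n2 := 1) (n3 := 0)).
  by apply: liftable_eq l => z _; rewrite mulrNz mulr0z addr0 addrC; exact: same_angle_refl.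
exact/pq/unbounded_components.
Qed.

End Poles.

(** * Adding an arc to a compact set *)

Section AddedArcs.
Context {R : realType}.
Implicit Types (p q r z w : R * R) (X K A : set (R * R)).

Lemma liftable_glue K1 K2 (th al be : R * R -> R) : closed K1 -> closed K2 ->
  {within K1, continuous al} -> {within K2, continuous be} ->
  (forall z, K1 z -> same_angle (al z) (th z)) ->
  (forall z, K2 z -> same_angle (be z) (th z)) ->
  (forall z, K1 z -> K2 z -> al z = be z) -> liftable (K1 `|` K2) th.
Proof.
move=> c1 c2 cal cbe alP beP ab.
pose f z := if pselect (K1 z) then al z else be z.
have f1 z : K1 z -> f z = al z by rewrite /f; case: pselect.
have f2 z : K2 z -> f z = be z by rewrite /f; case: pselect => //= k1 k2; exact: ab.
exists f.
  apply: withinU_continuous => //.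
    by apply: eq_within_continuous cal => z /f1.
  by apply: eq_within_continuous cbe => z /f2.
by move=> z [k|k]; [rewrite f1 //; exact: alP|rewrite f2 //; exact: beP].
Qed.

Lemma within_continuous_shift (T : topologicalType) (X : set T) (f : T -> R) c :
  {within X, continuous f} -> {within X, continuous (fun x => f x + c)}.
Proof. by move=> cf; apply: within_continuous_add => // x; exact: cst_continuous. Qed.

Lemma pole_angle_continuous A p q : ~ A p -> ~ A q ->
  angle_continuous A (fun z => arg (z - p) - arg (z - q)).
Proof.
move=> Ap Aq; apply: angle_continuousD; last apply: angle_continuousN.
  by apply: angle_continuousS (arg_continuous p) => z Az zp; apply: Ap; rewrite -zp.
by apply: angle_continuousS (arg_continuous q) => z Az zp; apply: Aq; rewrite -zp.
Qed.

Lemma acyclic_closed A : angle_acyclic A -> closed A.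
Proof. by move=> [cA _]; apply: compact_closed => //; exact: norm_hausdorff. Qed.

(** Determinations for the two poles exist on [K] and on [A]; at the only common
    point they differ by full turns, so one of them can be shifted to fit. *)
Lemma component_add_arc K A a p q : compact K -> angle_acyclic A ->
  K `&` A `<=` [set a] -> ~ A p -> ~ A q -> component K p q ->
  component (K `|` A) p q.
Proof.
move=> cK clA KA Ap Aq pq; have [cA lA] := clA.
have cK' : closed K by apply: compact_closed => //; exact: norm_hausdorff.
have Kp : ~ K p.
  by move=> Kp; move: pq; rewrite /component connected_component_out //; exact.
have Kq : ~ K q by exact: (connected_component_sub pq).
apply: two_poles_component => [||[]|]; first exact: compactU.
- by case.
- by [].
- by [].
have [al cal alP] := component_liftable cK' pq.
have [be cbe beP] := lA _ (pole_angle_continuous Ap Aq).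
have [[Ka Aa]|nKA] := pselect ((K `&` A) a); last first.
  apply: (liftable_glue cK' (acyclic_closed clA) cal cbe alP beP) => z Kz Az.
  by exfalso; apply: nKA; rewrite -(KA z).
apply: (liftable_glue cK' (acyclic_closed clA) cal _ alP
  (be := fun z => be z + (al a - be a))); first exact: within_continuous_shift.
  move=> z Az; rewrite -[arg (z - p) - _]addr0; apply: same_angleD; first exact: beP.
  rewrite -(subrr (arg (a - p) - arg (a - q))).
  by apply: same_angleD; [exact: alP|apply: same_angleN; exact: beP].
by move=> z Kz Az; rewrite (KA z) // addrC subrK.
Qed.

(** Two determinations, on [K] and on [A], can be fitted at [a], and then differ at
    [b] by a number of full turns: this integer is the only obstruction to
    gluing. The obstructions [m1] for the poles [p, q] and [m2] for [p, r] cancel in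
    the combination with coefficients [m2] and [- m1], which is therefore liftable,
    and the multiplicities of a liftable combination of poles in three different
    components vanish. *)
Lemma component_add_arc3 K A a b p q r : compact K -> angle_acyclic A ->
  K `&` A `<=` [set a; b] -> ~ A p -> ~ A q -> ~ A r ->
  component K p q -> component K p r ->
  [\/ component (K `|` A) p q, component (K `|` A) p r | component (K `|` A) q r].
Proof.
move=> cK clA KA Ap Aq Ar pq pr; have [cA lA] := clA.
have [[Ka Aa]|nKA] := pselect ((K `&` A) a); last first.
  apply: Or31; apply: (component_add_arc (a := b) cK clA _ Ap Aq pq) => z zKA.
  by have [za|//] := KA z zKA; exfalso; apply: nKA; rewrite -za.
have [[Kb Ab]|nKA] := pselect ((K `&` A) b); last first.
  apply: Or31; apply: (component_add_arc (a := a) cK clA _ Ap Aq pq) => z zKA.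
  by have [//|zb] := KA z zKA; exfalso; apply: nKA; rewrite -zb.
have cK' : closed K by apply: compact_closed => //; exact: norm_hausdorff.
have Kp : ~ K p.
  by move=> Kp; move: pq; rewrite /component connected_component_out //; exact.
have Kq : ~ K q by exact: (connected_component_sub pq).
have Kr : ~ K r by exact: (connected_component_sub pr).
have [al1 cal1 al1P] := component_liftable cK' pq.
have [be1 cbe1 be1P] := lA _ (pole_angle_continuous Ap Aq).
have [al2 cal2 al2P] := component_liftable cK' pr.
have [be2 cbe2 be2P] := lA _ (pole_angle_continuous Ap Ar).
have defect (al be th : R * R -> R) : (forall z, K z -> same_angle (al z) (th z)) ->
    (forall z, A z -> same_angle (be z) (th z)) ->
    exists m, (be b - al b) - (be a - al a) = (pi *+ 2) *~ m.
  move=> alP beP.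
  have ba z : K z -> A z -> same_angle (be z) (al z).
    by move=> Kz Az; apply: same_angle_trans (beP _ Az) (same_angle_sym (alP _ Kz)).
  have [m em] := ba b Kb Ab; have [n en] := ba a Ka Aa.
  by exists (m - n); rewrite em en mulrzBr.
have [m1 d1] := defect _ _ _ al1P be1P.
have [m2 d2] := defect _ _ _ al2P be2P.
apply: contrapT => no.
have comb (k1 k2 : int) : m1 * k1 + m2 * k2 = 0 -> k1 = 0 /\ k2 = 0.
  move=> k0.
  have : liftable (K `|` A) (fun z => arg (z - p) *~ (k1 + k2) +
      (arg (z - q) *~ (- k1) + arg (z - r) *~ (- k2))).
    pose al z := al1 z *~ k1 + al2 z *~ k2.
    pose be z := be1 z *~ k1 + be2 z *~ k2.
    have cM (X : set (R * R)) (f : R * R -> R) k : {within X, continuous f} ->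
        {within X, continuous (fun z => f z *~ k)}.
      move=> cf; rewrite (_ : (fun z => _) = (fun z => f z * k%:~R)).
        by apply: within_continuous_mul => // x; exact: cst_continuous.
      by apply/funext => z; rewrite mulrzr.
    have eth z : (arg (z - p) - arg (z - q)) *~ k1 + (arg (z - p) - arg (z - r)) *~ k2
       = arg (z - p) *~ (k1 + k2) + (arg (z - q) *~ (- k1) + arg (z - r) *~ (- k2)).
      by rewrite !mulrzBl mulrzDr !mulrNz addrACA.
    have alP z : K z -> same_angle (al z) (arg (z - p) *~ (k1 + k2) +
      (arg (z - q) *~ (- k1) + arg (z - r) *~ (- k2))).
      by move=> Kz; rewrite -eth; apply: same_angleD; apply: same_angleMz; [exact: al1P|exact: al2P].
    have beP z : A z -> same_angle (be z) (arg (z - p) *~ (k1 + k2) +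
      (arg (z - q) *~ (- k1) + arg (z - r) *~ (- k2))).
      by move=> Az; rewrite -eth; apply: same_angleD; apply: same_angleMz; [exact: be1P|exact: be2P].
    apply: (@liftable_glue _ _ _ al (fun z => be z + (al a - be a)) cK' (acyclic_closed clA)).
    - by apply: within_continuous_add; exact: cM.
    - by apply: within_continuous_shift; apply: within_continuous_add; exact: cM.
    - exact: alP.
    - move=> z Az; rewrite -[X in same_angle _ X]addr0.
      apply: same_angleD; first exact: beP.
      rewrite -(subrr (al a)); apply: same_angleD; first exact: same_angle_refl.
      apply: same_angleN; exact: same_angle_trans (beP _ Aa) (same_angle_sym (alP _ Ka)).
    - move=> z Kz Az; have [->|->] : z = a \/ z = b by exact: (KA z (conj Kz Az)).
        by rewrite addrC subrK.
      apply/eqP; rewrite -subr_eq0 /al /be.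
      rewrite (_ : _ - _ = - (((be1 b - al1 b) - (be1 a - al1 a)) *~ k1 +
        ((be2 b - al2 b) - (be2 a - al2 a)) *~ k2)); last first.
        have [x Mx] : exists x : R, forall u : R, u *~ k1 = u * x.
          by exists k1%:~R => u; rewrite mulrzr.
        have [y My] : exists y : R, forall u : R, u *~ k2 = u * y.
          by exists k2%:~R => u; rewrite mulrzr.
        by rewrite !Mx !My; ring.
      by rewrite d1 d2 -!mulrzA -mulrzDr k0 mulr0z oppr0.
  move=> /three_poles_rigid[]; first exact: compactU.
  - by case.
  - by case.
  - by case.
  - by move=> h; apply: no; apply: Or31.
  - by move=> h; apply: no; apply: Or32.
  - by move=> h; apply: no; apply: Or33.
  1-3: by clear; move=> [? ?]; split; lia.
(* the combination (m2, - m1) has no obstruction, so m1 = 0 and (1, 0) has none *)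
have [|m20 m10] := comb m2 (- m1); first by rewrite mulrN mulrC subrr.
have m10' : m1 = 0 by rewrite -[m1]opprK m10 oppr0.
by have [] := comb 1 0; rewrite ?m10' ?mulr0 ?mul0r ?addr0.
Qed.

(** The variation along the arc of the direction in which its points are seen
    from [z] depends continuously on [z] off the arc, and it is a determination of
    the difference of the angles at the two ends. *)
Lemma arc_winding_liftable (g : R -> R * R) : {within `[0, 1], continuous g} ->
  liftable (~` (g @` `[0, 1])) (fun z => arg (z - g 0) - arg (z - g 1)).
Proof.
move=> cg; set A := g @` `[0, 1].
have cA : closed A.
  apply: compact_closed; first exact: norm_hausdorff.
  by apply: continuous_compact => //; exact: segment_compact.
have Ag (t : R) : `[0, 1]%classic t -> A (g t) by move=> t01; exists t.
have I0 : `[0, 1]%classic (0 : R) by rewrite /= in_itv/= lexx ler01.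
have I1 : `[0, 1]%classic (1 : R) by rewrite /= in_itv/= lexx ler01.
have dgC z : {within `[0, 1], continuous (fun t => z - g t)}.
  by move=> t; apply: (@continuousB _ _ (subspace _)); [exact: cst_continuous|exact: cg].
have angleg z : ~ A z -> angle_continuous (`[0, 1] : set R) (fun t => arg (z - g t)).
  move=> Az; apply: (angle_continuous_eq (th := fun t => arg (z - g t - 0))).
    by move=> t _; rewrite subr0; exact: same_angle_refl.
  apply: (angle_continuous_comp (dgC z) _ (arg_continuous 0)) => t t01 /= /eqP.
  by rewrite subr_eq0 => /eqP zg; apply: Az; rewrite zg; exact: Ag.
pose P z (f : R -> R) := ~ A z -> {within `[0, 1], continuous f} /\
  forall t, (`[0, 1] : set R) t -> same_angle (f t) (arg (z - g t)).
have [th thP] : {th : R * R -> R -> R & forall z, P z (th z)}.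
  apply: choice => z; have [Az|Az] := pselect (A z); first by exists (fun=> 0).
  by have [f cf fP] := itv_liftable ler01 (angleg z Az); exists f.
exists (fun z => th z 0 - th z 1); last first.
  move=> z Az; have [_ eth] := thP z Az.
  by apply: same_angleD; [exact: eth|apply: same_angleN; exact: eth].
have oA : open (~` A) by exact: closed_openC.
rewrite continuous_open_subspace // => z0; rewrite inE => Az0.
have /nbhs_ballP[e /= e0 eA] : nbhs z0 (~` A) by exact: open_nbhs_nbhs.
set B := ball z0 (e / 2).
have BA z : B z -> ~ A z by move=> Bz; apply: eA; apply: le_ball Bz; lra.
have acute z t : B z -> `[0, 1]%classic t -> 0 < cos (arg (z0 - g t) - arg (z - g t)).
  move=> Bz t01; apply: acute_arg.
    move=> /eqP; rewrite subr_eq0 => /eqP zg; apply: Az0; rewrite zg; exact: Ag.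
  rewrite opprB addrA subrK.
  apply: (@lt_le_trans _ _ (e / 2)); first by move: Bz; rewrite /B -ball_normE.
  rewrite ler_pM2r ?invr_gt0 // leNgt; apply/negP => zg; apply: (eA (g t)).
    by rewrite -ball_normE.
  exact: Ag.
pose dl z t := asin (sin (arg (z0 - g t) - arg (z - g t))).
have eL z : B z -> th z0 0 - dl z 0 - (th z0 1 - dl z 1) = th z 0 - th z 1.
  move=> Bz; have Az := BA z Bz.
  have [cz0 ez0] := thP z0 Az0; have [cz ez] := thP z Az.
  pose h t := th z t - (th z0 t - dl z t).
  have ch : {within `[0, 1], continuous h}.
    apply: within_continuous_add => //; apply: within_continuous_opp.
    apply: within_continuous_add => //; apply: within_continuous_opp.
    apply: asin_sin_continuous; last by move=> t t01; exact: acute.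
    by apply: angle_continuousD; [exact: angleg|apply: angle_continuousN; exact: angleg].
  have h0 t : `[0, 1]%classic t -> same_angle (h t) 0.
    move=> t01; rewrite -(subrr (arg (z - g t))); apply: same_angleD; first exact: ez.
    apply: same_angleN; rewrite -[X in same_angle _ X](subKr (arg (z0 - g t))).
    apply: same_angleD; first exact: ez0.
    by apply: same_angleN; apply: asin_sin_same_angle; exact: acute.
  have := connected_same_angle (@segment_connected R 0 1) ch h0 I0 I1.
  rewrite /h; move: (th z 0) (th z0 0) (dl z 0) (th z 1) (th z0 1) (dl z 1) => *; lra.
have cB : {within B, continuous (fun z => th z 0 - th z 1)}.
  apply: eq_within_continuous eL _.
  have cdl t : `[0, 1]%classic t -> {within B, continuous (fun z => dl z t)}.
    move=> t01; apply: asin_sin_continuous; last by move=> z Bz; exact: acute.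
    apply: angle_continuousD.
      by apply: continuous_angle => z; exact: cst_continuous.
    apply: angle_continuousN; apply: angle_continuousS (arg_continuous (g t)).
    by move=> z /BA Az zg; apply: Az; rewrite zg; exact: Ag.
  have cst (c : R) : {within B, continuous (fun=> c)} by move=> z; exact: cst_continuous.
  by apply: within_continuous_add; [|apply: within_continuous_opp];
    (apply: within_continuous_add; [exact: cst|apply: within_continuous_opp; exact: cdl]).
move: cB; rewrite continuous_open_subspace; last exact: ball_open.
by apply; rewrite inE; apply: ballxx; rewrite divr_gt0.
Qed.

Lemma liftable_complementD (A B : set (R * R)) (th ph : R * R -> R) :
  liftable (~` A) th -> liftable (~` B) ph ->
  liftable (~` (A `|` B)) (fun z => th z + ph z).
Proof.
move=> lA lB; rewrite setCU; apply: liftableD.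
  by apply: liftableS lA; exact: subIsetl.
by apply: liftableS lB; exact: subIsetr.
Qed.

(** If the complement of the union were connected, the two determinations would
    differ by a constant there and could be glued to one that is defined off [a]
    and [b]. On a small circle around [a] the angle seen from [b] is liftable, so the
    angle seen from [a] would be liftable too. *)
Lemma two_arcs_separate (K1 K2 : set (R * R)) a b : closed K1 -> closed K2 ->
  a <> b -> K1 `&` K2 `<=` [set a; b] ->
  liftable (~` K1) (fun z => arg (z - a) - arg (z - b)) ->
  liftable (~` K2) (fun z => arg (z - a) - arg (z - b)) ->
  ~ connected (~` (K1 `|` K2)).
Proof.
move=> c1 c2 ab K12 [al cal alP] [be cbe beP] cD.
have [c cP c0] : exists2 c : R,
    forall z, ~ K1 z -> ~ K2 z -> al z = be z + c & same_angle c 0.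
  have [[z0 [n1 n2]]|nD] := pselect (~` K1 `&` ~` K2 !=set0); last first.
    exists 0; last exact: same_angle_refl.
    by move=> z n1 n2; exfalso; apply: nD; exists z.
  have dP z : (~` (K1 `|` K2)) z -> same_angle (al z - be z) 0.
    move=> /not_orP[k1 k2]; rewrite -(subrr (arg (z - a) - arg (z - b))).
    by apply: same_angleD; [exact: alP|apply: same_angleN; exact: beP].
  have D0 : (~` (K1 `|` K2)) z0 by move=> [].
  exists (al z0 - be z0); last exact: dP.
  move=> z k1 k2; have Dz : (~` (K1 `|` K2)) z by move=> [].
  rewrite -(connected_same_angle cD _ dP Dz D0) 1?addrC ?subrK //.
  apply: within_continuous_add; first by apply: continuous_subspaceW cal => w nw Kw; apply: nw; left.
  by apply: within_continuous_opp; apply: continuous_subspaceW cbe => w nw Kw; apply: nw; right.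
pose f z := if pselect (K1 z) then be z + c else al z.
have f1 z : ~ K1 z -> f z = al z by rewrite /f; case: pselect.
have f2 z : ~ K2 z -> f z = be z + c.
  by rewrite /f; case: pselect => //= n1 n2; exact: cP.
have fP z : ~ (K1 z /\ K2 z) -> same_angle (f z) (arg (z - a) - arg (z - b)).
  move=> nz; have [k1|k1] := pselect (K1 z); last by rewrite f1 //; exact: alP.
  have k2 : ~ K2 z by move=> k2; exact: nz.
  rewrite f2 // -[X in same_angle _ X]addr0; apply: same_angleD => //; exact: beP.
have o1 : open (~` K1) by exact: closed_openC.
have o2 : open (~` K2) by exact: closed_openC.
have cf : {within ~` K1 `|` ~` K2, continuous f}.
  rewrite continuous_open_subspace; last exact: openU.
  move=> z; rewrite inE => -[k1|k2].
    have : {within ~` K1, continuous f} by apply: eq_within_continuous cal => w /f1.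
    by rewrite continuous_open_subspace //; apply; rewrite inE.
  have : {within ~` K2, continuous f}.
    by apply: (eq_within_continuous _ (within_continuous_shift (c := c) cbe)) => w /f2.
  by rewrite continuous_open_subspace //; apply; rewrite inE.
have ab0 : a - b <> 0 by move=> /eqP; rewrite subr_eq0 => /eqP.
have nab : 0 < `|a - b| by rewrite normr_gt0; apply/eqP.
pose r : R := `|a - b| / 4; have r0 : 0 < r by rewrite divr_gt0.
have near_a z : circle a r z -> `|a - z| < `|a - b| / 2.
  move=> [t _ <-]; apply: (@le_lt_trans _ _ r); last by rewrite /r; lra.
  have rr (u v : R) : `|v| <= 1 -> `|u - (u + r * v)| <= r.
    by move=> v1; rewrite opprD addNKr normrN normrM (gtr0_norm r0) ler_piMr // ltW.
  by rewrite norm_pair_le /= !rr ?cos_max ?sin_max.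
have off z : circle a r z -> z <> a /\ z <> b.
  move=> cz; split=> zz; last by have := near_a z cz; rewrite zz; lra.
  have rr (u v : R) : u + r * v = u -> v = 0.
    move=> e; have /eqP : r * v = 0 by lra.
    by rewrite mulf_eq0 gt_eqF //= => /eqP.
  move: cz; rewrite zz => -[t _ e].
  have := cos2Dsin2 t; rewrite (rr _ _ (congr1 fst e)) (rr _ _ (congr1 snd e)).
  by rewrite !expr0n addr0 => /eqP; rewrite eq_sym oner_eq0.
have l1 : liftable (circle a r) (fun z => arg (z - a) - arg (z - b)).
  exists f.
    apply: continuous_subspaceW cf => z /off[za zb].
    rewrite -setCI => zK; case: (K12 z zK) => //.
  move=> z /off[za zb]; apply: fP => zK; by case: (K12 z zK).
have l2 : liftable (circle a r) (fun z => arg (a - b) - arg (z - b)).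
  apply: liftable_acute.
    apply: angle_continuousD; first by apply: continuous_angle => z; exact: cst_continuous.
    apply: angle_continuousN; apply: angle_continuousS (arg_continuous b).
    by move=> z /off[].
  move=> z cz; apply: acute_arg => //.
  by rewrite opprB addrA subrK; exact: near_a.
have l3 : liftable (circle a r) (fun=> arg (a - b)).
  exists (fun=> arg (a - b)) => [z|z _]; first exact: cst_continuous.
  exact: same_angle_refl.
suff : 1%:Z = 0 by [].
apply: (circle_not_liftable r0).
apply: liftable_eq (liftableD l1 (liftableD l3 (liftableN l2))) => z _.
rewrite subKr subrK.
exact: same_angle_refl.
Qed.

End AddedArcs.

(** * Edges of paths and cycles *)

Section EdgeLists.
Context {T : finType}.
Implicit Types (x y : T) (p c : seq T) (f : {set T}).

Lemma edgeC x y : edge x y = edge y x.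
Proof. exact: finset.setUC. Qed.

Lemma in_edge x y z : (z \in edge x y) = (z == x) || (z == y).
Proof. by rewrite /edge !inE. Qed.

Lemma path_edges_ends x p f v : f \in path_edges x p -> v \in f -> v \in x :: p.
Proof.
elim: p x => //= y p ih x; rewrite inE => /orP[/eqP ->|/ih h /h].
  by rewrite in_edge !inE => /orP[->|->]; rewrite ?orbT.
by rewrite [in X in _ -> X]inE => ->; rewrite orbT.
Qed.

Lemma cycle_edges_cons x p : uniq (x :: p) ->
  cycle_edges (x :: p) = rcons (path_edges x p) (edge (last x p) x).
Proof.
move=> u; have -> : rcons (path_edges x p) (edge (last x p) x) = pairmap edge x (rcons p x).
  by rewrite -cats1 -[in RHS]cats1 /path_edges pairmap_cat.
apply: (@eq_from_nth _ finset.set0).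
  by rewrite size_map size_pairmap size_rcons.
move=> i; rewrite size_map => ip.
rewrite (nth_map x) // (nth_pairmap x) ?size_rcons //.
rewrite -rcons_cons nth_rcons ip; congr edge.
rewrite next_nth mem_nth // index_uniq // nth_rcons.
by case: ltnP => // pi; rewrite nth_default //; case: eqP.
Qed.

Lemma cycle_edges_rot c n : uniq c -> cycle_edges (rot n c) = rot n (cycle_edges c).
Proof.
by move=> u; rewrite /cycle_edges map_rot; congr rot; apply: eq_map => x; rewrite next_rot.
Qed.

(** By rotation any edge becomes the one that closes the cycle, so that the cycle
    splits into a path and this edge. *)
Lemma cycle_edges_close (E : {set {set T}}) c f : is_cycle E c -> f \in cycle_edges c ->
  exists x p, [/\ is_cycle E (x :: p), cycle_edges (x :: p) =i cycle_edges c,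
    {subset x :: p <= c} & f = edge (last x p) x].
Proof.
move=> /and3P[c2 uc cc] fc; set i := index f (cycle_edges c).
have ic : (i < size (cycle_edges c))%N by rewrite index_mem.
have [x [p cE]] : exists x p, rot i.+1 c = x :: p.
  case E1 : (rot i.+1 c) => [|x p]; last by exists x, p.
  by move: c2; rewrite -(size_rot i.+1) E1.
have u' : uniq (x :: p) by rewrite -cE rot_uniq.
exists x, p; split.
- by rewrite /is_cycle -cE size_rot rot_uniq rot_cycle c2 uc cc.
- by move=> g; rewrite -cE cycle_edges_rot // mem_rot.
- by move=> v; rewrite -cE mem_rot.
have := cycle_edges_rot i.+1 uc; rewrite cE cycle_edges_cons //.
rewrite /rot (take_nth finset.set0 ic) -rcons_cat => /rcons_inj[_ ->].
by rewrite /i nth_index.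
Qed.

End EdgeLists.

(** * Drawn paths *)

Section Drawing.
Context {R : realType} {T : finType} {E : {set {set T}}} (G : plane_embedding R E).
Hypothesis E_simple : simple_graph E.
Implicit Types (x y v : T) (p c : seq T) (f g : {set T}) (S : seq {set T}).
Implicit Types (z w : R * R).

Notation vp := (vertex_point G).

Definition arcs S : set (R * R) := \bigcup_(f in [set f | f \in S]) arc_set G f.

Lemma arcs_nil : arcs [::] = set0.
Proof. by rewrite -subset0 => z [f]. Qed.

Lemma arcs_cons f S : arcs (f :: S) = arcs S `|` arc_set G f.
Proof.
apply/seteqP; split=> z.
  by move=> [g /=]; rewrite inE => /orP[/eqP ->|gS] gz; [right|left; exists g].
move=> [[g gS gz]|fz]; first by exists g => //=; rewrite inE gS orbT.
by exists f => //=; rewrite inE eqxx.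
Qed.

Lemma arcs_eq S S' : S =i S' -> arcs S = arcs S'.
Proof. by move=> e; apply/seteqP; split => z [f fS fz]; exists f; rewrite //= ?e // -e. Qed.

Lemma arcs_rcons f S : arcs (rcons S f) = arcs S `|` arc_set G f.
Proof. by rewrite -arcs_cons; apply: arcs_eq => g; rewrite mem_rcons. Qed.

Lemma edge_arc_ends_neq f : f \in E -> exists x y, [/\ f = edge x y, x != y,
  edge_arc G f 0 = vp x & edge_arc G f 1 = vp y].
Proof.
move=> fE; have [x [y [e h0 h1]]] := edge_arc_ends G fE; exists x, y; split=> //.
by apply/eqP => xy; have := E_simple fE; rewrite e xy /edge finset.setUid cards1.
Qed.

Lemma arc_set_acyclic f : f \in E -> angle_acyclic (arc_set G f).
Proof.
move=> fE; apply: arc_acyclic; first exact: ler01.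
  exact: edge_arc_continuous.
move=> s t; exact: edge_arc_inj.
Qed.

Lemma arc_set_vertex f x : f \in E -> x \in f -> arc_set G f (vp x).
Proof.
move=> fE xf; have [a [b [e e0 e1]]] := edge_arc_ends G fE.
move: xf; rewrite {1}e in_edge => /orP[]/eqP ->; [exists 0|exists 1] => //=.
  by rewrite in_itv/= lexx ler01.
by rewrite in_itv/= lexx ler01.
Qed.

Lemma arc_set_interior f z : f \in E -> arc_set G f z ->
  (exists2 x, x \in f & z = vp x) \/ (exists2 t, 0 < t < 1 & z = edge_arc G f t).
Proof.
move=> fE [t]; rewrite /= in_itv/= => /andP[t0 t1] <-.
have [a [b [e e0 e1]]] := edge_arc_ends G fE.
have [t0'|t0'] := eqVneq t 0.
  by left; exists a; rewrite ?t0' // e in_edge eqxx.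
have [t1'|t1'] := eqVneq t 1.
  by left; exists b; rewrite ?t1' // e in_edge eqxx orbT.
by right; exists t => //; rewrite !lt_neqAle t0 t1 eq_sym t0' t1'.
Qed.

Lemma arc_set_vertexP f x : f \in E -> arc_set G f (vp x) -> x \in f.
Proof.
move=> fE /(arc_set_interior fE)[[y yf /(@vertex_point_inj _ _ _ G) ->//]|[t t01 e]].
by have := edge_arc_avoids fE t01 (esym e).
Qed.

Lemma arc_setI f g z : f \in E -> g \in E -> f != g -> arc_set G f z -> arc_set G g z ->
  exists x, [/\ x \in f, x \in g & z = vp x].
Proof.
move=> fE gE /eqP fg fz gz.
case: (arc_set_interior fE fz) => [[x xf zx]|[t t01 zt]].
  by exists x; split=> //; apply: arc_set_vertexP => //; rewrite -zx.
case: (arc_set_interior gE gz) => [[x xg zx]|[s s01 zs]].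
  by case: (@edge_arc_avoids _ _ _ G f x t fE t01); rewrite -zt.
by case: (@edge_arc_disjoint _ _ _ G f g t s fE gE fg t01 s01); rewrite -zt.
Qed.

Lemma arcs_compact S : {subset S <= E} -> compact (arcs S).
Proof.
elim: S => [_|f S ih SE]; first by rewrite arcs_nil; exact: compact0.
rewrite arcs_cons; apply: compactU.
  by apply: ih => g gS; apply: SE; rewrite inE gS orbT.
by have [] := arc_set_acyclic (SE f (mem_head _ _)).
Qed.

Lemma path_edges_sub x p : path (adj E) x p -> {subset path_edges x p <= E}.
Proof.
elim: p x => //= y p ih x /andP[xy yp] f; rewrite inE => /orP[/eqP -> //|].
exact: ih.
Qed.

Lemma component_plane z w : component (set0 : set (R * R)) z w.
Proof.
exists setT => //; split=> //; first by rewrite setC0.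
exact: convex_connected.
Qed.

(** Added one by one, the edges of a path meet the part already drawn in a single
    point, so a drawn path does not separate the plane. *)
Lemma path_component x p z w : uniq (x :: p) -> path (adj E) x p ->
  ~ arcs (path_edges x p) z -> ~ arcs (path_edges x p) w ->
  component (arcs (path_edges x p)) z w.
Proof.
elim: p x => [|y p ih] x; first by rewrite arcs_nil => *; exact: component_plane.
move=> /andP[xp u] /andP[xy yp]; rewrite [path_edges _ _]/= arcs_cons => /not_orP[z1 z2] /not_orP[w1 w2].
apply: (@component_add_arc _ _ _ (vp y)) => //.
- by apply: arcs_compact; exact: path_edges_sub.
- exact: arc_set_acyclic.
- move=> q [[f fp fq] xyq].
  have fE := path_edges_sub yp fp.
  have xf : x \notin f by apply: contra xp; exact: path_edges_ends.
  have fxy : f != edge x y by apply: contraNneq xf => ->; rewrite in_edge eqxx.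
  have [v [vf]] := arc_setI fE xy fxy fq xyq.
  rewrite in_edge => /orP[/eqP vx|/eqP -> ->//].
  by move: xf; rewrite -vx vf.
- exact: ih.
Qed.

(** The contributions of the successive edges telescope. *)
Lemma path_winding_liftable x p : path (adj E) x p ->
  liftable (~` arcs (path_edges x p))
    (fun z => arg (z - vp x) - arg (z - vp (last x p))).
Proof.
elim: p x => [|y p ih] x /=.
  move=> _; exists (fun=> 0) => [z|z _]; first exact: cst_continuous.
  by rewrite subrr; exact: same_angle_refl.
move=> /andP[xy yp]; rewrite arcs_cons.
have lxy : liftable (~` arc_set G (edge x y)) (fun z => arg (z - vp x) - arg (z - vp y)).
  have l := arc_winding_liftable (edge_arc_continuous (p := G) xy).
  have [a [b [e ab e0 e1]]] := edge_arc_ends_neq xy.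
  move: l; rewrite e0 e1 => l.
  have : (a \in edge x y) && (b \in edge x y) by rewrite {1 2}e !in_edge !eqxx orbT.
  rewrite !in_edge => /andP[/orP[]/eqP ax /orP[]/eqP bx]; move: ab l; rewrite ax bx ?eqxx //.
  move=> _ l; apply: liftable_eq (liftableN l) => z _.
  by rewrite opprB; exact: same_angle_refl.
apply: liftable_eq (liftable_complementD (ih _ yp) lxy) => z _.
by rewrite addrC addrA subrK; exact: same_angle_refl.
Qed.

End Drawing.

(** * The Jordan curve theorem for drawn cycles *)

Section Jordan.
Context {R : realType} {T : finType} {E : {set {set T}}} (G : plane_embedding R E).
Hypothesis E_simple : simple_graph E.
Implicit Types (x y v : T) (p c : seq T) (f g : {set T}) (S : seq {set T}).
Implicit Types (z w : R * R).

Notation vp := (vertex_point G).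
Notation arcs := (arcs G).

Lemma components_connected (K : set (R * R)) :
  (forall z w, ~ K z -> ~ K w -> component K z w) -> connected (~` K).
Proof.
move=> Kc; have [[z Kz]|/nonemptyPn ->] := pselect ((~` K) !=set0); last exact: connected0.
rewrite (_ : ~` K = component K z); first exact: component_connected.
apply/seteqP; split=> w Kw; first exact: Kc.
exact: connected_component_sub Kw.
Qed.

Lemma closing_edge_mem x p : is_cycle E (x :: p) ->
  [/\ uniq (x :: p), path (adj E) x p, edge (last x p) x \in E & (1 < size p)%N].
Proof.
move=> /and3P[p2 u]; rewrite /= rcons_path => /andP[xp lx]; split=> //.
Qed.

Lemma closing_edge_new x p : uniq (x :: p) -> (1 < size p)%N ->
  edge (last x p) x \notin path_edges x p.
Proof.
case: p => // y p /= /and3P[xyp yp u] p1; apply/negP; rewrite inE => /orP[/eqP e|h].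
  have : last y p \in edge x y by rewrite -e in_edge eqxx.
  rewrite in_edge => /orP[/eqP lx|/eqP ly].
    by move: xyp; rewrite -lx mem_last.
  by case: p ly yp {xyp u e} p1 => //= a p <-; rewrite mem_last.
have := path_edges_ends h (v := x); rewrite in_edge eqxx orbT => /(_ isT).
by apply/negP.
Qed.

Lemma closing_arcI x p z : is_cycle E (x :: p) ->
  arcs (path_edges x p) z -> arc_set G (edge (last x p) x) z ->
  z = vp (last x p) \/ z = vp x.
Proof.
move=> /closing_edge_mem[u xp lx p1] [f fp fz] lz.
have fE := path_edges_sub xp fp.
have fl : f != edge (last x p) x by apply: contraNneq (closing_edge_new u p1) => <-.
have [v [_ + ->]] := arc_setI fE lx fl fz lz.
by rewrite in_edge => /orP[]/eqP ->; [left|right].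
Qed.

Lemma arcs_cycle_cons x p : uniq (x :: p) -> arcs (cycle_edges (x :: p)) =
  arcs (path_edges x p) `|` arc_set G (edge (last x p) x).
Proof. by move=> u; rewrite cycle_edges_cons // arcs_rcons. Qed.

Lemma cycle_edges_sub c : is_cycle E c -> {subset cycle_edges c <= E}.
Proof.
case: c => // x p /closing_edge_mem[u xp lx _] f.
rewrite cycle_edges_cons // mem_rcons inE => /orP[/eqP ->//|].
exact: path_edges_sub.
Qed.

Lemma cycle_arcs_compact c : is_cycle E c -> compact (arcs (cycle_edges c)).
Proof. by move=> cc; apply: arcs_compact => //; exact: cycle_edges_sub. Qed.

Lemma cycle_arcs_closed c : is_cycle E c -> closed (arcs (cycle_edges c)).
Proof.
by move/cycle_arcs_compact; apply: compact_closed; exact: norm_hausdorff.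
Qed.

Lemma arc_set_closed f : f \in E -> closed (arc_set G f).
Proof. by move=> fE; apply: acyclic_closed; exact: arc_set_acyclic. Qed.

Lemma arcs_closed S : {subset S <= E} -> closed (arcs S).
Proof.
by move=> SE; apply: compact_closed; [exact: norm_hausdorff|exact: arcs_compact].
Qed.

(** The cycle consists of a path and an edge with the same ends. *)
Lemma cycle_separates c : is_cycle E c -> exists z w,
  [/\ ~ arcs (cycle_edges c) z, ~ arcs (cycle_edges c) w &
      ~ component (arcs (cycle_edges c)) z w].
Proof.
case: c => // x p cc; have [u xp lx p1] := closing_edge_mem cc.
apply: contrapT => no.
have : connected (~` arcs (cycle_edges (x :: p))).
  apply: components_connected => z w Kz Kw; apply: contrapT => nzw; apply: no.
  by exists z, w.
rewrite arcs_cycle_cons //; apply: (@two_arcs_separate _ _ _ (vp x) (vp (last x p))).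
- by apply: arcs_closed; exact: path_edges_sub.
- exact: arc_set_closed.
- move=> /(@vertex_point_inj _ _ _ G) e; move: u p1; rewrite e.
  by case: (p) => //= y q /andP[]; rewrite mem_last.
- by move=> z [h1 h2]; have [->|->] := closing_arcI cc h1 h2; [right|left].
- exact: path_winding_liftable.
have := @path_winding_liftable _ _ _ G E_simple (last x p) [:: x].
rewrite /= /adj lx => /(_ isT) l; have {l} := liftableN l.
rewrite arcs_cons arcs_nil set0U; apply: liftable_eq => z _.
by rewrite opprB; exact: same_angle_refl.
Qed.

(** The path does not separate the plane, and adding the closing edge to it cannot
    create three components. *)
Lemma cycle_two_sides c z w q : is_cycle E c ->
  ~ arcs (cycle_edges c) z -> ~ arcs (cycle_edges c) w -> ~ arcs (cycle_edges c) q ->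
  [\/ component (arcs (cycle_edges c)) z w, component (arcs (cycle_edges c)) z q
    | component (arcs (cycle_edges c)) w q].
Proof.
case: c => // x p cc; have [u xp lx p1] := closing_edge_mem cc.
rewrite arcs_cycle_cons // => /not_orP[z1 z2] /not_orP[w1 w2] /not_orP[q1 q2].
apply: (@component_add_arc3 _ _ _ (vp (last x p)) (vp x)) => //.
- by apply: arcs_compact => //; exact: path_edges_sub.
- exact: arc_set_acyclic.
- by move=> r [h1 h2]; exact: closing_arcI h1 h2.
- exact: path_component.
- exact: path_component.
Qed.

Lemma arc_dense f (C : set (R * R)) : f \in E -> closed C ->
  (forall t, 0 < t < 1 -> C (edge_arc G f t)) -> arc_set G f `<=` C.
Proof.
move=> fE cC fC; suff H (t0 : R) : 0 <= t0 -> t0 <= 1 -> C (edge_arc G f t0).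
  by move=> _ [t + <-]; rewrite /= in_itv/= => /andP[]; exact: H.
move=> t0' t1'; apply: contrapT => nC.
have /subspace_continuousP := edge_arc_continuous (p := G) fE.
have tI : (`[0, 1] : set R) t0 by rewrite /= in_itv/= t0' t1'.
move=> /(_ t0 tI (~` C)).
have : nbhs (edge_arc G f t0) (~` C).
  by apply: open_nbhs_nbhs; split => //; exact: closed_openC.
move=> h /(_ h); rewrite /nbhs /= /within /= => /nbhs_ballP[e /= e0 eC].
have [d [d0 d1 de]] : exists d : R, [/\ 0 < d, d <= 1 / 2 & d < e].
  exists (Num.min e 1 / 2); split.
  - by rewrite divr_gt0 // lt_min e0 ltr01.
  - by rewrite ler_pM2r ?invr_gt0 // ge_min lexx orbT.
  - rewrite ltr_pdivrMr //; apply: (@le_lt_trans _ _ e); first by rewrite ge_min lexx.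
    by rewrite ltr_pMr // ltr1n.
have [t [t01 tt0]] : exists t : R, 0 < t < 1 /\ `|t0 - t| < e.
  have [h1|h1] := leP t0 (1 / 2).
    exists (t0 + d / 2); split; first by apply/andP; split; lra.
    by rewrite ltr_norml; apply/andP; split; lra.
  exists (t0 - d / 2); split; first by apply/andP; split; lra.
  by rewrite ltr_norml; apply/andP; split; lra.
apply: (eC t) => //; last exact: fC.
by rewrite in_itv /=; case/andP: t01 => *; apply/andP; split; exact: ltW.
Qed.

(** Otherwise cut a short piece around the point out of the closing edge. The path
    with the two remaining pieces of the edge does not separate the plane, but the
    side would be open and closed in its complement. *)
Lemma side_closure_interior x p z t : is_cycle E (x :: p) ->
  ~ arcs (cycle_edges (x :: p)) z -> 0 < t < 1 ->
  closure (component (arcs (cycle_edges (x :: p))) z)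
    (edge_arc G (edge (last x p) x) t).
Proof.
move=> cc Jz /andP[t0 t1]; have [u xp lx p1] := closing_edge_mem cc.
set e := edge (last x p) x in lx *; set z0 := edge_arc G e t.
set J := arcs _ in Jz *; set K' := arcs (path_edges x p).
have JE : J = K' `|` arc_set G e by exact: arcs_cycle_cons.
have cJ : closed J by exact: cycle_arcs_closed.
set F := component J z.
have clF : closure F `<=` F `|` J by exact: closure_component.
apply: contrapT => nz0.
have oF : open F by apply: component_open; exact: closed_openC.
have cE := edge_arc_continuous (p := G) lx.
have inI (s : R) : 0 <= s -> s <= 1 -> (`[0, 1] : set R) s.
  by move=> s0 s1; rewrite /= in_itv/= s0 s1.
have arcI (s : R) : 0 <= s -> s <= 1 -> arc_set G e (edge_arc G e s).
  by move=> s0 s1; exists s => //; exact: inI.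
have [s1 [s2 [/andP[s10 s1t] /andP[ts2 s21] sF]]] : exists s1 s2 : R,
    [/\ 0 < s1 < t, t < s2 < 1 & forall s, s1 < s < s2 -> ~ closure F (edge_arc G e s)].
  have /subspace_continuousP := cE.
  move=> /(_ t (inI t (ltW t0) (ltW t1)) (~` closure F)).
  have : nbhs z0 (~` closure F).
    by apply: open_nbhs_nbhs; split => //; apply: closed_openC; exact: closed_closure.
  move=> h /(_ h); rewrite /nbhs /= /within /= => /nbhs_ballP[d /= d0 dF].
  pose d' : R := Num.min d (Num.min t (1 - t)) / 2.
  have d'0 : 0 < d' by rewrite divr_gt0 // !lt_min d0 t0 subr_gt0.
  have [h1 h2 h3] : [/\ d' <= d / 2, d' <= t / 2 & d' <= (1 - t) / 2].
    by split; rewrite ler_pM2r ?invr_gt0 // !ge_min lexx ?orbT.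
  exists (t - d'), (t + d'); split; try by apply/andP; split; lra.
  move=> s /andP[sl sr]; apply: dF.
    by rewrite /ball /= ltr_norml; apply/andP; split; lra.
  by rewrite in_itv/=; apply/andP; split; lra.
pose A1 := edge_arc G e @` `[0, s1]; pose A2 := edge_arc G e @` `[s2, 1].
have inj_e (a b s s' : R) : 0 <= a -> b <= 1 -> a <= s <= b -> a <= s' <= b ->
    edge_arc G e s = edge_arc G e s' -> s = s'.
  by move=> a0 b1 /andP[? ?] /andP[? ?]; apply: edge_arc_inj => //; apply/andP; split; lra.
have clA (a b : R) : 0 <= a -> a <= b -> b <= 1 -> angle_acyclic (edge_arc G e @` `[a, b]).
  move=> a0 ab b1; apply: arc_acyclic => //; last by move=> s s'; exact: inj_e.
  apply: continuous_subspaceW cE => s; rewrite /= !in_itv/= => /andP[? ?].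
  by apply/andP; split; lra.
have A1e : A1 `<=` arc_set G e.
  by move=> _ [s + <-]; rewrite /= in_itv/= => /andP[? ?]; apply: arcI; lra.
have A2e : A2 `<=` arc_set G e.
  by move=> _ [s + <-]; rewrite /= in_itv/= => /andP[? ?]; apply: arcI; lra.
have K'e s : K' (edge_arc G e s) -> 0 <= s <= 1 -> s = 0 \/ s = 1.
  move=> Ks /andP[s0' s1'].
  have [a [b [_ _ e0 e1]]] := edge_arc_ends_neq G E_simple lx.
  case: (eqVneq s 0) => [->|s0]; [by left|]; case: (eqVneq s 1) => [->|s1'']; [by right|].
  have s01 : 0 < s < 1 by rewrite !lt_neqAle s0' s1' eq_sym s0 s1''.
  by have [h|h] := closing_arcI cc Ks (arcI _ s0' s1');
    case: (@edge_arc_avoids _ _ _ G e _ s lx s01 h).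
have K'z0 : ~ K' z0.
  by move=> /K'e []; [rewrite (ltW t0) (ltW t1)|lra|lra].
have K'z : ~ K' z by move=> h; apply: Jz; rewrite JE; left.
have A1z : ~ A1 z by move=> /A1e h; apply: Jz; rewrite JE; right.
have A2z : ~ A2 z by move=> /A2e h; apply: Jz; rewrite JE; right.
have nA (s : R) (a b : R) : 0 <= s <= 1 -> 0 <= a -> b <= 1 ->
     (edge_arc G e @` `[a, b]) (edge_arc G e s) -> a <= s <= b.
  move=> s01 a0 b1 [s' + ]; rewrite /= in_itv/= => /andP[as' s'b] es.
  have -> // : s = s'; last by rewrite as' s'b.
  by apply: (edge_arc_inj lx s01 _ (esym es)); apply/andP; split; lra.
have t01 : 0 <= t <= 1 by rewrite (ltW t0) (ltW t1).
have A1z0 : ~ A1 z0.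
  move=> h; have s1' : s1 <= 1 by lra.
  by have /andP[_] := nA t 0 s1 t01 (lexx _) s1' h; lra.
have A2z0 : ~ A2 z0.
  move=> h; have s2' : 0 <= s2 by lra.
  by have /andP[] := nA t s2 1 t01 s2' (lexx _) h; lra.
have c1 : component K' z z0 by exact: path_component.
have cK' : compact K' by apply: arcs_compact => //; exact: path_edges_sub.
have clA1 : angle_acyclic A1 by apply: clA; lra.
have clA2 : angle_acyclic A2 by apply: clA; lra.
have c2 : component (K' `|` A1) z z0.
  apply: (component_add_arc (a := edge_arc G e 0) cK' clA1) => //.
  move=> w [K's [s + es]]; rewrite -{w}es in K's *; rewrite /= in_itv/= => /andP[h1 h2].
  have s01 : 0 <= s <= 1 by apply/andP; split; lra.
  by have [->//|s1'] := K'e s K's s01; exfalso; lra.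
have cK1 : compact (K' `|` A1) by apply: compactU => //; case: clA1.
have c3 : component ((K' `|` A1) `|` A2) z z0.
  apply: (component_add_arc (a := edge_arc G e 1) cK1 clA2) => //.
  move=> w [K's [s + es]]; rewrite -{w}es in K's *; rewrite /= in_itv/= => /andP[h1 h2].
  have s01 : 0 <= s <= 1 by apply/andP; split; lra.
  case: K's => [/K'e /(_ s01)[s0'|->//]|h]; first by exfalso; lra.
  exfalso; have s1' : s1 <= 1 by lra.
  by have /andP[_] := nA s 0 s1 s01 (lexx _) s1' h; lra.
have [C [Cz CK cC] Cz0] := c3.
have CF : C `&` F = C.
  apply: cC; first by exists z; split=> //; exact: connected_component_refl.
    by exists F.
  exists (closure F); first exact: closed_closure.
  apply/seteqP; split => w [Cw Fw]; split=> //; first exact: subset_closure.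
  have [//|Jw] := clF w Fw; exfalso.
  have nK := CK w Cw.
  move: Jw; rewrite JE => -[K'w|[s]]; first by apply: nK; left; left.
  rewrite /= in_itv/= => /andP[h1 h2] es.
  have [s1s|s1s] := leP s s1.
    by apply: nK; left; right; exists s => //=; rewrite in_itv/= h1.
  have [s2s|s2s] := leP s2 s.
    by apply: nK; right; exists s => //=; rewrite in_itv/= h2 s2s.
  by apply: (sF s); [rewrite s1s|rewrite es].
have [_ Fz0] : (C `&` F) z0 by rewrite CF.
have : (~` J) z0 by exact: (connected_component_sub Fz0).
by apply; rewrite JE; right; apply: arcI; lra.
Qed.

(** Rotating the cycle brings any of its edges into the closing position, where the
    previous lemma applies; the ends of the edge follow because the closure is
    closed. *)
Lemma side_frontier c z : is_cycle E c -> ~ arcs (cycle_edges c) z ->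
  frontier (component (arcs (cycle_edges c)) z) = arcs (cycle_edges c).
Proof.
move=> cc Jz; set J := arcs _ in Jz *.
have cJ : closed J by exact: cycle_arcs_closed.
have oF : open (component J z) by apply: component_open; exact: closed_openC.
rewrite /frontier; have -> : interior (component J z) = component J z.
  apply/seteqP; split; [exact: interior_subset|by rewrite -open_subsetE].
apply/seteqP; split=> w.
  by move=> [/(closure_component cJ)[]].
move=> Jw; split; last by move=> Fw; exact: (connected_component_sub Fw).
case: Jw => f fc; have [x [p [cc' e _ fe]]] := cycle_edges_close cc fc.
have eJ : J = arcs (cycle_edges (x :: p)) by apply: arcs_eq => g; rewrite e.
have fE : f \in E by apply: (cycle_edges_sub cc).
move: w; apply: arc_dense => //; first exact: closed_closure.
move=> t t01; rewrite eJ fe; apply: side_closure_interior => //.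
by rewrite -eJ.
Qed.

End Jordan.

(** * Perfect matchings and the associated orientation *)

Section Matchings.
Context {T : finType} (E : {set {set T}}).
Hypothesis E_simple : simple_graph E.
Implicit Types (x y u v : T) (M N : {set {set T}}) (f g : {set T}) (c p : seq T).

Lemma adj_neq x y : adj E x y -> x != y.
Proof.
by move=> xy; apply/eqP => e; have := E_simple xy; rewrite e /edge finset.setUid cards1.
Qed.

Lemma edge_of f x : f \in E -> x \in f -> exists2 y, f = edge x y & y != x.
Proof.
move=> fE xf; have /eqP/cards2P[a [b [ab fab]]] := E_simple fE.
move: xf; rewrite fab !inE => /orP[]/eqP ->.
  by exists b => //; rewrite eq_sym.
by exists a => //; rewrite /edge finset.setUC.
Qed.

Lemma edge_inj x y z : edge x y = edge x z -> y = z.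
Proof.
move=> e; have : y \in edge x z by rewrite -e in_edge eqxx orbT.
rewrite in_edge => /orP[/eqP yx|/eqP //].
have : z \in edge x y by rewrite e in_edge eqxx orbT.
by rewrite in_edge yx orbb => /eqP.
Qed.

Lemma perfect_matchingP M : reflect
  (M \subset E /\ forall x, exists2 f, f \in M /\ x \in f &
     forall g, g \in M -> x \in g -> g = f)
  (perfect_matching E M).
Proof.
apply: (iffP andP) => -[ME MP]; split=> //.
  move=> x; have /forallP/(_ x)/cards1P[f Mf] := MP.
  have : f \in [set f]%SET by rewrite inE.
  rewrite -Mf inE => /andP[fM xf]; exists f => // g gM xg.
  by have : g \in [set f]%SET by [rewrite -Mf inE gM xg]; rewrite inE => /eqP.
apply/forallP => x; apply/cards1P; have [f [fM xf] fP] := MP x.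
exists f; apply/setP => g; rewrite !inE; apply/andP/eqP => [[gM xg]|->//].
exact: fP.
Qed.

Definition mate M x := odflt x [pick y | edge x y \in M].

Section Mate.
Variable M : {set {set T}}.
Hypothesis M_pm : perfect_matching E M.

Lemma matching_sub f : f \in M -> f \in E.
Proof. by have /perfect_matchingP[/fintype.subsetP ME _] := M_pm; exact: ME. Qed.

Lemma mateP x : edge x (mate M x) \in M.
Proof.
rewrite /mate; case: pickP => [y //|no].
have /perfect_matchingP[_ /(_ x)[f [fM xf] _]] := M_pm.
have [y fy _] := edge_of (matching_sub fM) xf.
by have := no y; rewrite -fy fM.
Qed.

Lemma mate_adj x : adj E x (mate M x).
Proof. exact: matching_sub (mateP x). Qed.

Lemma mate_unique x y : edge x y \in M -> mate M x = y.
Proof.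
move=> xyM; have /perfect_matchingP[_ /(_ x)[f _ fP]] := M_pm.
apply: (@edge_inj x); rewrite (fP _ xyM) ?in_edge ?eqxx //.
by rewrite (fP _ (mateP x)) // in_edge eqxx.
Qed.

Lemma mateK : involutive (mate M).
Proof. by move=> x; apply: mate_unique; rewrite edgeC; exact: mateP. Qed.

Lemma mate_neq x : mate M x != x.
Proof. by rewrite eq_sym; exact: adj_neq (mate_adj x). Qed.

Lemma matched_edge f x : f \in M -> x \in f -> f = edge x (mate M x).
Proof.
move=> fM xf; have [y fy _] := edge_of (matching_sub fM) xf.
by rewrite fy (mate_unique (y := y)) // -fy.
Qed.

End Mate.

Section Orientation.
Variable A : {set T}.
Hypothesis A_bip : forall x y, adj E x y -> (x \in A) != (y \in A).

(** Matching edges leave [A] and the others enter it. Directed cycles alternate,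
    and if [M] is a perfect matching each vertex has one outgoing arc if it lies in
    [A], and one incoming arc otherwise. *)
Definition darc M : rel T := fun x y => adj E x y && ((x \in A) == (edge x y \in M)).

Lemma darc_adj M : subrel (darc M) (adj E).
Proof. by move=> x y /andP[]. Qed.

Lemma darc_antisym M x y : darc M x y -> ~~ darc M y x.
Proof.
move=> /andP[xy /eqP e]; apply/negP => /andP[_ /eqP]; rewrite edgeC -e => e'.
by have := A_bip xy; rewrite e' eqxx.
Qed.

Lemma darc_orient M x y : adj E x y -> darc M x y || darc M y x.
Proof.
move=> xy; rewrite /darc xy /adj (edgeC y x) -/(adj E x y) xy /=.
by have := A_bip xy; case: (x \in A) (y \in A) (edge x y \in M) => [] [] [].
Qed.

Lemma dcycle_alternating M c : is_cycle E c -> cycle (darc M) c ->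
  alternating_cycle E M c.
Proof.
move=> cc dc; rewrite /alternating_cycle cc /=; apply/allP => x xc.
have /andP[px /eqP <-] := prev_cycle dc xc.
have /andP[_ /eqP <-] := next_cycle dc xc.
exact: A_bip.
Qed.

Section TwoMatchings.
Variables M N : {set {set T}}.
Hypotheses (M_pm : perfect_matching E M) (N_pm : perfect_matching E N).

(** This map follows [M] out of [A] and [N] into [A]. It is a bijection, so its orbits
    are cycles; they are directed wherever [M] and [N] differ. *)
Definition alternate x := if x \in A then mate M x else mate N x.

Lemma mate_side K x : perfect_matching E K -> (mate K x \in A) = (x \notin A).
Proof.
by move=> Kpm; have := A_bip (mate_adj Kpm x); case: (x \in A); case: (_ \in A).
Qed.

Lemma alternate_inj : injective alternate.
Proof.
apply: (can_inj (g := fun x => if x \in A then mate N x else mate M x)) => x.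
rewrite /alternate; case xA: (x \in A); rewrite mate_side // xA /= mateK //.
Qed.

Definition differ x := mate M x != mate N x.

Lemma differ_mate x : differ x -> differ (mate M x) /\ differ (mate N x).
Proof.
move=> dx; split; apply: contra dx => /eqP e; apply/eqP.
  by rewrite -[LHS](mateK N_pm) -e mateK.
by rewrite -[RHS](mateK M_pm) e mateK.
Qed.

Lemma differ_alternate x : differ x -> differ (alternate x).
Proof. by move=> /differ_mate[? ?]; rewrite /alternate; case: ifP. Qed.

Lemma darc_alternate x : differ x -> darc M x (alternate x).
Proof.
rewrite /differ /darc /alternate => dx; case: ifP => xA.
  by rewrite mate_adj // mateP.
rewrite mate_adj //=; apply/negP => h; case/negP: dx; apply/eqP.
exact: mate_unique.
Qed.

Lemma differ_orbit x y : differ x -> fconnect alternate x y -> connect (darc M) x y.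
Proof.
move=> dx /connectP[p + ->]; elim: p x dx => //= y' p ih x dx /andP[/eqP <- pp].
apply: connect_trans (connect1 (darc_alternate dx)) _.
by apply: ih => //; exact: differ_alternate.
Qed.

(** The vertex and its two partners lie on one orbit of [alternate], which is a
    directed cycle. *)
Lemma differ_mate_connect x : differ x ->
  [/\ connect (darc M) x (mate M x), connect (darc M) (mate M x) x,
      connect (darc M) x (mate N x) & connect (darc M) (mate N x) x].
Proof.
move=> dx; have [dM dN] := differ_mate dx.
have sy := fconnect_sym alternate_inj.
have fM : fconnect alternate x (mate M x).
  case xA : (x \in A); first by rewrite (_ : mate M x = alternate x) ?fconnect1 // /alternate xA.
  have ax : alternate (mate M x) = x by rewrite /alternate mate_side // xA mateK.
  by rewrite sy -[X in fconnect _ _ X]ax fconnect1.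
have fN : fconnect alternate x (mate N x).
  case xA : (x \in A); last by rewrite (_ : mate N x = alternate x) ?fconnect1 // /alternate xA.
  have ax : alternate (mate N x) = x by rewrite /alternate mate_side // xA mateK.
  by rewrite sy -[X in fconnect _ _ X]ax fconnect1.
by split; apply: differ_orbit => //; rewrite sy.
Qed.

(** The orbit under [alternate] of a vertex where the matchings differ. *)
Lemma two_matchings_dcycle : M <> N -> exists c,
  [/\ is_cycle E c, cycle (darc M) c & forall f, f \in cycle_edges c -> f \in M :|: N].
Proof.
move=> MN; have [x dx] : exists x, differ x.
  apply: contrapT => no; apply: MN; apply/setP => f.
  have e x : mate M x = mate N x by apply/eqP; apply: contrapT => /negP h; apply: no; exists x.
  apply/idP/idP => fM.
    have [x xf] : exists x, x \in f.
      by apply/set0Pn; rewrite -card_gt0 (E_simple (matching_sub M_pm fM)).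
    by rewrite (matched_edge M_pm fM xf) e mateP.
  have [x xf] : exists x, x \in f.
    by apply/set0Pn; rewrite -card_gt0 (E_simple (matching_sub N_pm fM)).
  by rewrite (matched_edge N_pm fM xf) -e mateP.
have dall y : y \in orbit alternate x -> differ y.
  rewrite -fconnect_orbit => /connectP[p pp ->].
  elim: p x dx pp => //= z p ih y' dy' /andP[/eqP <- pp].
  by apply: ih => //; exact: differ_alternate.
have fc := cycle_orbit alternate_inj x.
have cn y : y \in orbit alternate x -> next (orbit alternate x) y = alternate y.
  by move=> yo; apply/esym/eqP; exact: (next_cycle fc yo).
exists (orbit alternate x); split.
- rewrite /is_cycle orbit_uniq /=; apply/andP; split; last first.
    apply: (sub_in_cycle _ _ fc (P := mem (orbit alternate x))); last by apply/allP.
    move=> y z yo _ /eqP <-; apply: darc_adj; exact/darc_alternate/dall.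
  rewrite size_orbit; have := iter_order alternate_inj x.
  have := order_gt0 alternate x.
  case: (fingraph.order _ _) => [//|[_ /= e|[_ /= e|//]]].
    by have := adj_neq (darc_adj (darc_alternate dx)); rewrite e eqxx.
  have /negP := darc_antisym (darc_alternate dx); case.
  by rewrite -[X in darc _ _ X]e; exact/darc_alternate/differ_alternate.
- apply: (sub_in_cycle _ _ fc (P := mem (orbit alternate x))); last by apply/allP.
  move=> y z yo _ /eqP <-; exact/darc_alternate/dall.
- move=> f /mapP[y yo ->]; rewrite cn // /alternate !inE.
  by case: ifP => _; rewrite mateP ?orbT.
Qed.

End TwoMatchings.

(** An allowed edge outside [M] lies on an orbit of [alternate] for [M] and another
    matching. An edge of [M] need not be in the symmetric difference with any
    given matching, but as there is a third vertex some allowed edge leaves its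
    two ends, and the orbit through that edge passes through them. *)
Lemma strongly_connected M : elementary E -> perfect_matching E M -> (2 < #|T|)%N ->
  forall x y, connect (darc M) x y.
Proof.
move=> [_ el] Mpm T2.
have inM x : edge x (mate M x) \in allowed E.
  rewrite inE; apply/andP; split; first exact: mate_adj.
  by apply/existsP; exists M; rewrite Mpm mateP.
have con x y : connect (adj (allowed E)) x y.
  have cov z : z \in finset.cover (allowed E).
    by apply/bigcupP; exists (edge z (mate M z)) => //; rewrite in_edge eqxx.
  exact: el.
pose both x y := connect (darc M) x y && connect (darc M) y x.
have stepM x : both x (mate M x).
  have [z zx] : exists z, z \notin [set x; mate M x]%SET.
    apply: contrapT => no; move: T2; rewrite -cardsT ltnNge => /negP; apply.
    apply: (@leq_trans #|[set x; mate M x]%SET|); last by rewrite cards2; case: (_ != _).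
    apply/subset_leq_card/fintype.subsetP => z _; apply: contrapT => /negP h.
    by apply: no; exists z.
  have [u [v [ux vx uv]]] : exists u v, [/\ u \in [set x; mate M x]%SET,
      v \notin [set x; mate M x]%SET & edge u v \in allowed E].
    have /connectP[p + zp] := con x z.
    have : x \in [set x; mate M x]%SET by rewrite !inE eqxx.
    move: zx; rewrite zp; move: [set x; mate M x]%SET => B.
    elim: p x {zp z} => [x /negP //|y p ih x /= zB xB /andP[xy pp]].
    have [yB|yB] := boolP (y \in B); first exact: ih pp.
    by exists x, y.
  move: uv; rewrite inE => /andP[uvE /existsP[N /andP[Npm uvN]]].
  have du : differ M N u.
    apply: contra vx; rewrite (mate_unique Npm uvN) => /eqP <-.
    by move: ux; rewrite !inE => /orP[]/eqP ->; rewrite ?eqxx ?orbT // mateK ?eqxx.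
  have [h1 h2 _ _] := differ_mate_connect Mpm Npm du.
  by move: ux h1 h2; rewrite !inE /both => /orP[]/eqP ->; rewrite ?mateK // => -> ->.
have step x y : adj (allowed E) x y -> both x y.
  rewrite /adj inE => /andP[xyE /existsP[N /andP[Npm xyN]]].
  have [e|dx] := eqVneq (mate M x) (mate N x).
    by rewrite -(mate_unique Npm xyN) -e.
  have [_ _ h3 h4] := differ_mate_connect Mpm Npm dx.
  by rewrite /both -(mate_unique Npm xyN) h3 h4.
move=> x y; have /connectP[p + ->] := con x y.
elim: p x => [x _|z p ih x /= /andP[/step/andP[xz _] pp]]; first exact: connect0.
exact: connect_trans xz (ih _ pp).
Qed.

End Orientation.
End Matchings.

(** * Exchange along an alternating cycle *)

Section AlternatingCycles.
Context {T : finType} (E : {set {set T}}).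
Hypothesis E_simple : simple_graph E.
Implicit Types (x y u v : T) (M N : {set {set T}}) (f g : {set T}) (c p : seq T).

Lemma cycle_edges_next c x : x \in c -> edge x (next c x) \in cycle_edges c.
Proof. by move=> xc; apply/mapP; exists x. Qed.

Lemma cycle_edges_prev c x : uniq c -> x \in c -> edge (prev c x) x \in cycle_edges c.
Proof.
move=> u xc; rewrite -[X in edge _ X](next_prev u x).
by apply: cycle_edges_next; rewrite mem_prev.
Qed.

Lemma cycle_edges_at c f x : uniq c -> f \in cycle_edges c -> x \in f ->
  x \in c /\ (f = edge (prev c x) x \/ f = edge x (next c x)).
Proof.
move=> u /mapP[y yc ->]; rewrite in_edge => /orP[]/eqP ->; first by split; [|right].
by rewrite mem_next prev_next //; split; [|left].
Qed.

Section Alternating.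
Variables (M : {set {set T}}) (c : seq T).
Hypotheses (M_pm : perfect_matching E M) (c_alt : alternating_cycle E M c).

Lemma alternating_is_cycle : is_cycle E c.
Proof. by case/andP: c_alt. Qed.

Lemma alternating_uniq : uniq c.
Proof. by have /and3P[] := alternating_is_cycle. Qed.

Lemma alternating_at x : x \in c ->
  (edge (prev c x) x \in M) != (edge x (next c x) \in M).
Proof. by move=> xc; have /andP[_ /allP/(_ x xc)] := c_alt. Qed.

Lemma alternating_mate x : x \in c -> edge x (mate M x) \in cycle_edges c.
Proof.
move=> xc; have := alternating_at xc.
have [h _|h] := boolP (edge x (next c x) \in M).
  by rewrite (mate_unique E_simple M_pm h); exact: cycle_edges_next.
rewrite eqbF_neg negbK edgeC => {}h.
rewrite (mate_unique E_simple M_pm h) edgeC.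
by apply: cycle_edges_prev => //; exact: alternating_uniq.
Qed.

Lemma cycle_edges_in_graph : {subset cycle_edges c <= E}.
Proof. exact: cycle_edges_sub alternating_is_cycle. Qed.

(** The symmetric difference of [M] with the cycle is again a perfect matching. *)
Lemma alternating_cycle_swap f : f \notin cycle_edges c -> f \notin M ->
  exists2 N, perfect_matching (E :\ f)%SET N & N <> M.
Proof.
move=> fc fM; pose N := [set g in E | (g \in cycle_edges c) (+) (g \in M)]%SET.
have uc := alternating_uniq.
exists N; last first.
  have [x xc] : exists x, x \in c.
    by have /and3P[] := alternating_is_cycle; case: (c) => // x p _ _ _; exists x; rewrite mem_head.
  move=> NM; have mM := mateP E_simple M_pm x.
  have : edge x (mate M x) \in N by rewrite NM.
  by rewrite inE alternating_mate // mM andbF.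
apply/perfect_matchingP; split.
  apply/fintype.subsetP => g; rewrite !inE => /andP[gE gN]; rewrite gE andbT.
  by apply: contraTneq gN => ->; rewrite (negbTE fc) (negbTE fM).
move=> x; have [xc|xc] := boolP (x \in c); last first.
  have nc g : x \in g -> g \notin cycle_edges c.
    by move=> xg; apply: contra xc => /(cycle_edges_at uc)/(_ xg)[].
  exists (edge x (mate M x)).
    rewrite in_edge eqxx; split=> //; rewrite inE (negbTE (nc _ _)) ?in_edge ?eqxx //=.
    by rewrite (mateP E_simple M_pm) andbT; exact: (mate_adj E_simple M_pm).
  move=> g; rewrite inE => /andP[gE]; move=> + xg; rewrite (negbTE (nc _ xg)) /= => gM.
  exact: (matched_edge E_simple).
have alt := alternating_at xc.
pose h := if edge x (next c x) \in M then edge (prev c x) x else edge x (next c x).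
have hc : h \in cycle_edges c.
  by rewrite /h; case: ifP => _; [exact: cycle_edges_prev|exact: cycle_edges_next].
have hM : h \notin M.
  by rewrite /h; move: alt; case: (boolP (edge x (next c x) \in M)); rewrite ?eqb_id.
exists h.
  split; last by rewrite /h; case: ifP => _; rewrite in_edge eqxx ?orbT.
  by rewrite inE cycle_edges_in_graph // hc (negbTE hM).
move=> g; rewrite inE => /andP[gE gN] xg.
have [gc|gc] := boolP (g \in cycle_edges c); last first.
  move: gN; rewrite (negbTE gc) /= => gM; case/negP: gc.
  by rewrite (matched_edge E_simple M_pm gM xg); exact: alternating_mate.
move: gN; rewrite gc /= => gM.
have [_ [ge|ge]] := cycle_edges_at uc gc xg; rewrite /h ge.
  by move: alt; rewrite -ge (negbTE gM); case: ifP.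
by rewrite -ge (negbTE gM).
Qed.

End Alternating.
End AlternatingCycles.

(** * Edges drawn in a side of a cycle *)

Section Sides.
Context {R : realType} {T : finType} {E : {set {set T}}} (G : plane_embedding R E).
Hypothesis E_simple : simple_graph E.
Implicit Types (x y v : T) (p c : seq T) (f g : {set T}) (S : seq {set T}).
Implicit Types (z w : R * R).

Notation vp := (vertex_point G).
Notation arcs := (arcs G).
Notation side c z := (component (arcs (cycle_edges c)) z).

Definition midpoint f := edge_arc G f (1 / 2).

Lemma half_in : 0 < (1 / 2 : R) < 1. Proof. by apply/andP; split; lra. Qed.

Lemma midpoint_in f : arc_set G f (midpoint f).
Proof. by exists (1 / 2) => //=; rewrite in_itv/=; apply/andP; split; lra. Qed.

Lemma connected_in_component (K C : set (R * R)) z w : connected C -> C `<=` ~` K ->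
  C z -> C w -> component K z w.
Proof. by move=> cC CK Cz Cw; exists C. Qed.

Section Side.
Variables (c : seq T) (z : R * R).
Hypotheses (c_cycle : is_cycle E c) (z_off : ~ arcs (cycle_edges c) z).
Notation J := (arcs (cycle_edges c)).

Lemma side_closure : closure (side c z) `<=` side c z `|` J.
Proof. by apply: closure_component; exact: cycle_arcs_closed. Qed.

Lemma side_open w : open (side c w).
Proof. by apply: component_open; apply: closed_openC; exact: cycle_arcs_closed. Qed.

Lemma vertex_off_cycle v : v \notin c -> ~ J (vp v).
Proof.
move=> vc [f fc fv]; have fE := cycle_edges_sub c_cycle fc.
have vf := arc_set_vertexP fE fv; have /and3P[_ u _] := c_cycle.
by have [vc' _] := cycle_edges_at u fc vf; rewrite vc' in vc.
Qed.

Lemma edge_point_off_cycle f (t : R) : f \in E -> f \notin cycle_edges c ->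
  0 < t < 1 -> ~ J (edge_arc G f t).
Proof.
move=> fE fc t01 [g gc gt].
have fg : f != g by apply: contraNneq fc => ->.
have [|x [_ _ e]] := arc_setI fE (cycle_edges_sub c_cycle gc) fg _ gt.
  exists t => //=; rewrite in_itv/=; case/andP: t01 => *.
  by apply/andP; split; exact: ltW.
exact: (@edge_arc_avoids _ _ _ G f x t fE t01 e).
Qed.

Lemma open_edge_component f (s t : R) : f \in E -> f \notin cycle_edges c ->
  0 < s < 1 -> 0 < t < 1 -> side c (edge_arc G f s) (edge_arc G f t).
Proof.
move=> fE fc s01 t01.
apply: (@connected_in_component _ (edge_arc G f @` `]0, 1[)).
- apply: connected_continuous_connected.
    by apply/connected_intervalP; exact: interval_is_interval.
  by apply: continuous_subspaceW (edge_arc_continuous (p := G) fE); exact: subset_itv_oo_cc.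
- move=> _ [r + <-]; rewrite /= in_itv/= => r01.
  exact: edge_point_off_cycle.
- by exists s => //=; rewrite in_itv.
- by exists t => //=; rewrite in_itv.
Qed.

(** An edge that is not on the cycle runs in one side, which can be told from its
    midpoint. *)
Definition inside : pred {set T} := fun f => (f \in E) && `[< side c z (midpoint f) >].

Lemma inside_in f : inside f -> f \in E.
Proof. by case/andP. Qed.

Lemma inside_mid f : inside f -> side c z (midpoint f).
Proof. by case/andP=> _ /asboolP. Qed.

Lemma inside_not_cycle f : inside f -> f \notin cycle_edges c.
Proof.
move=> fi; apply/negP => fc; apply: (connected_component_sub (inside_mid fi)).
by exists f => //; exact: midpoint_in.
Qed.

Lemma inside_closure f : inside f -> arc_set G f `<=` closure (side c z).
Proof.
move=> fi; apply: arc_dense; first exact: inside_in.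
  exact: closed_closure.
move=> t t01; apply: subset_closure; apply: component_trans (inside_mid fi) _.
by apply: open_edge_component => //; [exact: inside_in|exact: inside_not_cycle|exact: half_in].
Qed.

Lemma inside_vertex f v : inside f -> v \in f -> v \notin c -> side c z (vp v).
Proof.
move=> fi vf vc; have := inside_closure fi (arc_set_vertex G (inside_in fi) vf).
by move=> /side_closure[//|/(vertex_off_cycle vc)].
Qed.

Lemma inside_of_point f w : f \in E -> side c z w -> arc_set G f w -> inside f.
Proof.
move=> fE sw fw; rewrite /inside fE /=; apply/asboolP; apply: contrapT => nm.
have fc : f \notin cycle_edges c.
  by apply/negP => fc; apply: (connected_component_sub sw); exists f.
suff : (~` side c z) w by [].
apply: (arc_dense fE _ _ fw); first by apply: open_closedC; exact: side_open.
move=> t t01 st; apply: nm; apply: component_trans st _.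
by apply: open_edge_component => //; exact: half_in.
Qed.

End Side.

Hypothesis E_cover : forall v, exists2 f, f \in E & v \in f.

Lemma drawing_arcs : drawing G = arcs (enum E).
Proof.
apply/seteqP; split=> w.
  move=> [[v _ <-]|[f /= fE fw]]; last by exists f; rewrite //= mem_enum.
  have [f fE vf] := E_cover v; exists f; rewrite /= ?mem_enum //.
  exact: arc_set_vertex.
by move=> [f]; rewrite /= mem_enum => fE fw; right; exists f.
Qed.

Lemma cycle_sub_drawing c : is_cycle E c -> arcs (cycle_edges c) `<=` drawing G.
Proof.
by move=> cc w [f fc fw]; right; exists f => //; exact: (cycle_edges_sub cc).
Qed.

Lemma empty_side_resonant c z M : is_cycle E c -> ~ arcs (cycle_edges c) z ->
  alternating_cycle E M c -> (forall f, ~~ inside c z f) ->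
  resonant_face G M (side c z).
Proof.
move=> cc Jz alt no.
have sd : side c z `<=` ~` drawing G.
  move=> w sw; rewrite drawing_arcs => -[f]; rewrite /= mem_enum => fE fw.
  by have /negP := no f; apply; exact: inside_of_point sw fw.
split; last by exists c => //; exact: side_frontier.
exists z; first by apply: sd; exact: connected_component_refl.
apply/seteqP; split.
  move=> w [C [Cz CJ cC] Cw]; exists (side c z).
    split; [exact: connected_component_refl|exact: sd|exact: component_connected].
  by exists C.
move=> w [C [Cz CJ cC] Cw]; exists C => //; split=> //.
by move=> q /CJ nq /(cycle_sub_drawing cc).
Qed.

Lemma cycle_other_side c z : is_cycle E c -> ~ arcs (cycle_edges c) z ->
  exists2 w, ~ arcs (cycle_edges c) w & ~ side c z w.
Proof.
move=> cc Jz; have [a [b [Ja Jb nab]]] := cycle_separates G E_simple cc.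
have [za|] := pselect (side c z a); last by exists a.
exists b => // zb; apply: nab; apply: component_trans zb.
exact: component_sym.
Qed.

(** The other side of [c] is connected and disjoint from the drawing of [c'], so it
    lies in one side of [c']. The opposite side of [c'] is open and disjoint from it,
    hence from its closure, which contains the drawing of [c]. *)
Lemma smaller_side c z c' : is_cycle E c -> ~ arcs (cycle_edges c) z ->
  is_cycle E c' ->
  (forall f, f \in cycle_edges c' -> f \in cycle_edges c \/ inside c z f) ->
  exists2 z', ~ arcs (cycle_edges c') z' & side c' z' `<=` side c z.
Proof.
move=> cc Jz cc' sub.
have [w Jw zw] := cycle_other_side cc Jz.
have disj : side c w `<=` ~` arcs (cycle_edges c').
  move=> q wq [f fc' fq]; have nJq := connected_component_sub wq.
  have [fc|fi] := sub f fc'; first by apply: nJq; exists f.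
  have [zq|//] := side_closure cc (inside_closure cc fi fq).
  by apply: zw; apply: component_trans zq (component_sym wq).
have J'w : ~ arcs (cycle_edges c') w by apply: disj; exact: connected_component_refl.
have [z' J'z' wz'] := cycle_other_side cc' J'w.
exists z' => // q z'q.
have nwq : ~ side c w q.
  move=> wq; apply: wz'; apply: component_trans (component_sym z'q).
  by exists (side c w) => //; split; [exact: connected_component_refl| |exact: component_connected].
have nJ : side c' z' `<=` ~` arcs (cycle_edges c).
  move=> r z'r; rewrite -(side_frontier E_simple cc Jw) => -[cl _].
  have [|s [ws z's]] := cl (side c' z').
    by apply: open_nbhs_nbhs; split=> //; exact: side_open.
  apply: wz'; apply: component_trans (component_sym z's).
  by exists (side c w) => //; split; [exact: connected_component_refl| |exact: component_connected].
by have [//|//|] := cycle_two_sides cc Jz Jw (nJ q z'q).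
Qed.

End Sides.

(** * Ears and resonant faces *)

Lemma path_edges_rcons (T : finType) (x y : T) p :
  path_edges x (rcons p y) = rcons (path_edges x p) (edge (last x p) y).
Proof. by rewrite -!cats1 /path_edges pairmap_cat. Qed.

Section Ears.
Context {R : realType} {T : finType} {E : {set {set T}}} (G : plane_embedding R E).
Hypothesis E_simple : simple_graph E.
Variable A : {set T}.
Hypothesis A_bip : forall x y, adj E x y -> (x \in A) != (y \in A).
Variable M : {set {set T}}.
Hypothesis M_pm : perfect_matching E M.
Hypothesis D_strong : forall x y, connect (darc E A M) x y.
Implicit Types (x y v : T) (p c : seq T) (f g : {set T}).
Implicit Types (z w : R * R).

Notation vp := (vertex_point G).
Notation arcs := (arcs G).
Notation side c z := (component (arcs (cycle_edges c)) z).
Notation D := (darc E A M).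

Section Ear.
Variables (c : seq T) (z : R * R).
Hypotheses (c_cycle : is_cycle E c) (c_dir : cycle D c).
Hypothesis z_off : ~ arcs (cycle_edges c) z.
Notation inside := (inside G c z).

Definition inside_arc x y := D x y && inside (edge x y).

Lemma inside_arc_vertex x y v : inside_arc x y -> v \in edge x y -> v \notin c ->
  side c z (vp v).
Proof. by move=> /andP[_ i]; exact: inside_vertex. Qed.

Lemma arc_at_inside x y v : D x y -> v \in edge x y -> side c z (vp v) ->
  inside_arc x y.
Proof.
move=> dxy vxy sv; rewrite /inside_arc dxy /=.
have xyE : edge x y \in E by exact: darc_adj dxy.
by apply: (inside_of_point _ xyE sv) => //; exact: arc_set_vertex.
Qed.

Lemma cycle_nonempty : exists x, x \in c.
Proof.
by have /and3P[] := c_cycle; case: (c) => // x p _ _ _; exists x; rewrite mem_head.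
Qed.

(** A directed walk that starts in the side can leave it only through a vertex of
    the cycle, and strong connectivity leads it there. *)
Lemma reach_cycle b : b \in c \/ side c z (vp b) ->
  exists2 y, y \in c & connect inside_arc b y.
Proof.
move=> [bc|sb]; first by exists b => //; exact: connect0.
apply: contrapT => no.
have nc y : connect inside_arc b y -> y \notin c.
  by move=> by_; apply/negP => yc; apply: no; exists y.
have [x0 x0c] := cycle_nonempty.
have /connectP[p pp e] := D_strong b x0.
suff : connect inside_arc b x0 by move=> /nc; rewrite x0c.
have claim q : forall v, connect inside_arc b v -> path D v q -> side c z (vp v) ->
    connect inside_arc b (last v q); last by rewrite e; apply: claim => //; exact: connect0.
elim: q => //= u q ih v bv /andP[vu pq] sv.
have iv : inside_arc v u by apply: (arc_at_inside vu) sv; rewrite in_edge eqxx.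
have bu := connect_trans bv (connect1 iv).
apply: ih => //; apply: (inside_arc_vertex iv); first by rewrite in_edge eqxx orbT.
exact: nc.
Qed.

(** The same, following the arcs backwards. *)
Lemma reach_from_cycle a : a \in c \/ side c z (vp a) ->
  exists2 x, x \in c & connect inside_arc x a.
Proof.
move=> [ac|sa]; first by exists a => //; exact: connect0.
apply: contrapT => no.
have nc x : connect inside_arc x a -> x \notin c.
  by move=> xa; apply/negP => xc; apply: no; exists x.
have [x0 x0c] := cycle_nonempty.
have /connectP[p pp e] := D_strong x0 a.
suff [/nc] : connect inside_arc x0 a /\ side c z (vp x0) by rewrite x0c.
elim: p x0 pp e {x0c} => /= [x0 _ <-|u p ih x0 /andP[cu pp] e]; first by split; rewrite ?connect0.
have [ua su] := ih u pp e.
have iv : inside_arc x0 u by apply: (arc_at_inside cu) su; rewrite in_edge eqxx orbT.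
have ca := connect_trans (connect1 iv) ua; split=> //.
apply: (inside_arc_vertex iv); first by rewrite in_edge eqxx.
exact: nc.
Qed.

(** A vertex of [A] has a single outgoing arc, its matching edge, and for a vertex
    of the cycle this arc belongs to the cycle. *)
Lemma inside_arc_out x v : x \in c -> inside_arc x v -> x \notin A.
Proof.
move=> xc /andP[/andP[_ /eqP xv] i]; apply/negP => xA.
have /andP[_ /eqP xn] := next_cycle c_dir xc.
move: xv xn; rewrite xA => /esym xv /esym xn.
have /negP := inside_not_cycle i; apply.
rewrite -(mate_unique E_simple M_pm xv) (mate_unique E_simple M_pm xn).
exact: cycle_edges_next.
Qed.

(** A vertex outside [A] has a single incoming arc, its matching edge, and for a
    vertex of the cycle this arc belongs to the cycle. *)
Lemma inside_arc_in u y : y \in c -> inside_arc u y -> y \in A.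
Proof.
move=> yc /andP[/andP[uy /eqP uyM] i]; apply: contrapT => /negP yA.
have /andP[py /eqP pyM] := prev_cycle c_dir yc.
have inA x : adj E x y -> x \in A by move/A_bip; rewrite (negbTE yA); case: (x \in A).
move: uyM pyM; rewrite (inA _ uy) (inA _ py) => /esym uyM /esym pyM.
have /negP := inside_not_cycle i; apply.
have e : prev c y = u.
  rewrite edgeC in uyM; rewrite edgeC in pyM.
  by rewrite -(mate_unique E_simple M_pm uyM) (mate_unique E_simple M_pm pyM).
by rewrite -e; apply: cycle_edges_prev => //; have /and3P[] := c_cycle.
Qed.

(** Cutting a walk at its first return makes its inner vertices avoid [P]. *)
Lemma first_hit (e : rel T) (P : pred T) x p : path e x p -> p != [::] -> P (last x p) ->
  exists q y, [/\ path e x (rcons q y), P y & all (predC P) q].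
Proof.
elim: p x => // y p ih x /= /andP[xy pp] _ Pl.
have [Py|nPy] := boolP (P y); first by exists [::], y; rewrite /= xy.
have pn : p != [::] by case: p Pl {pp ih} => //= Py; rewrite Py in nPy.
have [q [y' [pq Py' aq]]] := ih y pp pn Pl.
by exists (y :: q), y'; rewrite /= xy pq nPy.
Qed.

(** Extend the edge to a directed walk between vertices of the cycle and stop it at
    its first return to the cycle. Its ends are distinct because only the last one
    lies in [A]. *)
Lemma inside_ear f : inside f -> exists x y q,
  [/\ (x \in c) && (x \notin A), (y \in c) && (y \in A),
      path inside_arc x (rcons q y), uniq (x :: rcons q y) &
      {in q, forall v, v \notin c}].
Proof.
move=> fi; have fE := inside_in fi.
have [u0 [v0 [e _ _ _]]] := edge_arc_ends_neq G E_simple fE.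
have [u [v iuv]] : exists u v, inside_arc u v.
  have uvE : adj E u0 v0 by rewrite /adj -e.
  case/orP: (darc_orient A_bip M uvE) => d.
    by exists u0, v0; rewrite /inside_arc d -e.
  by exists v0, u0; rewrite /inside_arc d edgeC -e.
have off (w : T) : w \in edge u v -> w \in c \/ side c z (vp w).
  move=> wuv; have [|wc] := boolP (w \in c); first by left.
  by right; exact: (inside_arc_vertex iuv).
have [|x xc /connectP[p1 pp1 e1]] := reach_from_cycle (a := u).
  by apply: off; rewrite in_edge eqxx.
have [|y0 yc /connectP[p2 pp2 e2]] := reach_cycle (b := v).
  by apply: off; rewrite in_edge eqxx orbT.
have [|||q [y [pq yc' /allP qc]]] := @first_hit inside_arc (mem c) x (p1 ++ v :: p2).
- by rewrite cat_path pp1 /= -e1 iuv.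
- by case: (p1).
- by rewrite last_cat /= -e2.
have xA : x \notin A.
  case: q pq {qc} => [|v' q'] /= /andP[xv _]; exact: inside_arc_out xv.
have yA : y \in A.
  by move: pq; rewrite rcons_path => /andP[_]; exact: inside_arc_in.
have xy : x != y by apply: contraNneq xA => ->.
have := last_rcons x q y; case/shortenP: pq => p' pp' up' sub lp'.
case/lastP: p' pp' up' sub lp' => [|q' y'] pp' up' sub.
  by move=> /= xy'; rewrite xy' eqxx in xy.
rewrite last_rcons => yy'; rewrite {}yy' in pp' up' sub.
have yc'' : y \in c by [].
exists x, y, q'; split; rewrite ?xc ?yc'' //.
move=> w wq'; have := sub w; rewrite !mem_rcons !inE wq' orbT => /(_ isT).
case/orP => [/eqP wy|/qc//].
by move: up'; rewrite /= rcons_uniq -wy wq' /= andbF.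
Qed.

Lemma path_edges_inside x p g : path inside_arc x p -> g \in path_edges x p -> inside g.
Proof.
elim: p x => //= y p ih x /andP[/andP[_ i] pp]; rewrite inE => /orP[/eqP -> //|].
exact: ih.
Qed.

(** The ear, followed by the part of the cycle that leads from its end back to its
    start. *)
Lemma reroute f : inside f -> exists c', [/\ is_cycle E c', cycle D c',
  forall g, g \in cycle_edges c' -> g \in cycle_edges c \/ inside g &
  exists2 g, g \in cycle_edges c' & inside g].
Proof.
move=> /inside_ear[x [y [q [/andP[xc xA] /andP[yc yA] pq uq qc]]]].
have /and3P[_ uc _] := c_cycle.
have xy : y != x by apply: contraNneq xA => <-.
have [i p1 p2 _ _ ec] := rot_to_arc uc yc xc xy.
have urot : uniq (y :: p1 ++ x :: p2) by rewrite -ec rot_uniq.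
have Drot : cycle D (y :: p1 ++ x :: p2) by rewrite -ec rot_cycle.
have mrot v : (v \in c) = (v \in y :: p1 ++ x :: p2) by rewrite -ec mem_rot.
have erot : cycle_edges c =i cycle_edges (y :: p1 ++ x :: p2).
  by move=> g; rewrite -ec cycle_edges_rot // mem_rot.
have Dq : path D x (rcons q y) by apply: sub_path pq => a b /andP[].
have D1 : path D y (rcons p1 x).
  by move: Drot; rewrite /= rcons_cat rcons_cons -cat_rcons cat_path => /andP[].
pose c' := y :: p1 ++ x :: q.
have Dc' : cycle D c'.
  rewrite /= rcons_cat rcons_cons -cat_rcons cat_path D1 last_rcons; exact: Dq.
have pc v : v \in rcons (y :: p1) x -> v \in c.
  by rewrite mrot mem_rcons !inE !mem_cat !inE => /orP[->|/orP[->|->]]; rewrite ?orbT.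
have c'E : c' = rcons (y :: p1) x ++ q by rewrite cat_rcons.
have uc' : uniq c'.
  rewrite c'E cat_uniq; apply/and3P; split.
  - by move: urot; rewrite -cat_cons -cat_rcons cat_uniq => /andP[].
  - by apply/hasPn => v /qc; apply: contra => /pc.
  - by move: uq; rewrite /= rcons_uniq => /and3P[].
have c'2 : (2 < size c')%N.
  rewrite /= size_cat /=; case: (p1) D1 => [|? ?]; last by rewrite /= addSn ltnS addnS.
  case: (q) Dq => [|? ?]; last by rewrite /= !addnS.
  rewrite /= !andbT => /andP[_ /eqP] + /andP[_ /eqP]; rewrite yA (negbTE xA) edgeC => <- //.
have cc' : is_cycle E c'.
  rewrite /is_cycle c'2 uc'; apply: sub_cycle Dc' => a b; exact: darc_adj.
have ec' : cycle_edges c' = path_edges y (rcons p1 x) ++ path_edges x (rcons q y).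
  rewrite cycle_edges_cons // -path_edges_rcons rcons_cat rcons_cons -cat_rcons.
  by rewrite /path_edges pairmap_cat last_rcons.
exists c'; split=> //.
  move=> g; rewrite ec' mem_cat => /orP[gp|gq]; [left|right].
    rewrite erot cycle_edges_cons // mem_rcons inE; apply/orP; right.
    by rewrite -cat_rcons /path_edges pairmap_cat mem_cat gp.
  exact: path_edges_inside gq.
have [g gq] : exists g, g \in path_edges x (rcons q y).
  by case: (q) => [|a ?]; [exists (edge x y)|exists (edge x a)]; rewrite /= mem_head.
exists g; first by rewrite ec' mem_cat gq orbT.
exact: path_edges_inside gq.
Qed.

End Ear.

Definition inside_count c z := #|[set f | inside G c z f]%SET|.

Hypothesis E_cover : forall v, exists2 f, f \in E & v \in f.

(** If no edge is drawn in the side, it is a face. Otherwise a rerouted cycle has a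
    side within the given one that contains fewer edges, since the edges of the
    ear are now on the cycle. *)
Lemma resonant_in_side c z : is_cycle E c -> cycle D c ->
  ~ arcs (cycle_edges c) z ->
  exists2 F, resonant_face G M F & F `<=` side c z.
Proof.
move: {2}(inside_count c z).+1 (ltnSn (inside_count c z)) => n.
elim: n c z => // n ih c z; rewrite ltnS => cn cc dc Jz.
have [/existsP[f fi]|/existsPn no] := boolP [exists f, inside G c z f]; last first.
  exists (side c z) => //; apply: empty_side_resonant => //.
  exact: (dcycle_alternating A_bip).
have [c' [cc' dc' sub [g gc' gi]]] := reroute cc dc fi.
have [z' Jz' zz'] := smaller_side E_simple cc Jz cc' sub.
have lt : (inside_count c' z' < n)%N.
  apply: leq_trans cn; apply: proper_card; apply/properP; split.
    apply/fintype.subsetP => h; rewrite !inE => /andP[hE /asboolP hs].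
    by rewrite /inside hE; apply/asboolP; exact: zz'.
  exists g; rewrite inE //; apply/negP => /andP[_ /asboolP gs].
  by apply: (connected_component_sub gs); exists g => //; exact: midpoint_in.
have [F rF FS] := ih c' z' lt cc' dc' Jz'.
by exists F => //; exact: subset_trans zz'.
Qed.

End Ears.

(** * Faces at an edge *)

Section Faces.
Context {R : realType} {T : finType} {E : {set {set T}}} (G : plane_embedding R E).
Hypothesis E_simple : simple_graph E.
Hypothesis E_cover : forall v, exists2 f, f \in E & v \in f.
Implicit Types (x y v : T) (p c : seq T) (f g : {set T}) (F : set (R * R)).

Notation vp := (vertex_point G).
Notation arcs := (arcs G).
Notation side c z := (component (arcs (cycle_edges c)) z).

Lemma face_nonempty F : face G F -> F !=set0.
Proof.
by move=> [z Dz ->]; exists z; exact: connected_component_refl.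
Qed.

Lemma face_component F z : face G F -> F z -> F = component (drawing G) z.
Proof. by move=> [w Dw ->]; exact: same_connected_component. Qed.

Lemma face_sub F : face G F -> F `<=` ~` drawing G.
Proof. by move=> [w Dw ->]; exact: connected_component_sub. Qed.

Lemma face_connected F : face G F -> connected F.
Proof. by move=> [w Dw ->]; exact: component_connected. Qed.

(** The component is a neighbourhood of the midpoint, which is adherent to the
    face, so it meets the face; and the face is connected. *)
Lemma face_in_component F f (K : set (R * R)) : face G F -> arc_set G f `<=` frontier F ->
  closed K -> K `<=` drawing G -> ~ K (midpoint G f) -> F `<=` component K (midpoint G f).
Proof.
move=> Ff fF cK KD Km q Fq; have [cl _] := fF _ (midpoint_in G f).
have [|r [Fr mr]] := cl (component K (midpoint G f)).
  apply: open_nbhs_nbhs; split; last exact: connected_component_refl.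
  by apply: component_open; exact: closed_openC.
apply: component_trans mr _; exists F => //; split=> //; last exact: face_connected.
by move=> s /(face_sub Ff) ns /KD.
Qed.

(** Erasing the edge puts the faces that touch it into one component, and drawing
    it again cannot split this component into three. *)
Lemma two_faces_at_edge f F1 F2 F3 : f \in E ->
  face G F1 -> face G F2 -> face G F3 ->
  arc_set G f `<=` frontier F1 -> arc_set G f `<=` frontier F2 ->
  arc_set G f `<=` frontier F3 -> [\/ F1 = F2, F1 = F3 | F2 = F3].
Proof.
move=> fE f1 f2 f3 h1 h2 h3; pose S := rem f (enum E).
have SE g : g \in S -> g \in E /\ f != g.
  by rewrite mem_rem_uniq ?enum_uniq // !inE mem_enum eq_sym => /andP[].
have SE' : {subset S <= E} by move=> g /SE[].
have dE : drawing G = arcs S `|` arc_set G f.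
  rewrite (drawing_arcs G E_cover) -arcs_cons; apply: arcs_eq.
  by apply: perm_mem; apply: perm_to_rem; rewrite mem_enum.
have cS : closed (arcs S) by exact: arcs_closed.
have Sm : ~ arcs S (midpoint G f).
  move=> [g /SE[gE fg] gm].
  have [x [_ _ e]] := arc_setI fE gE fg (midpoint_in G f) gm.
  exact: (@edge_arc_avoids _ _ _ G f x _ fE (half_in) e).
have SD : arcs S `<=` drawing G by rewrite dE; exact: subsetUl.
have [z1 F1z] := face_nonempty f1; have [z2 F2z] := face_nonempty f2.
have [z3 F3z] := face_nonempty f3.
have m1 := face_in_component f1 h1 cS SD Sm F1z.
have m2 := face_in_component f2 h2 cS SD Sm F2z.
have m3 := face_in_component f3 h3 cS SD Sm F3z.
have off F z : face G F -> F z -> ~ arc_set G f z.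
  by move=> Ff Fz fz; apply: (face_sub Ff Fz); rewrite dE; right.
have [u [v [e _ _ _]]] := edge_arc_ends_neq G E_simple fE.
rewrite (face_component f1 F1z) (face_component f2 F2z) (face_component f3 F3z).
have [] := @component_add_arc3 _ (arcs S) (arc_set G f) (vp u) (vp v) z1 z2 z3.
- exact: arcs_compact.
- exact: arc_set_acyclic.
- move=> z [[g /SE[gE fg] gz] fz].
  have [x [+ _ ->]] := arc_setI fE gE fg fz gz.
  by rewrite e in_edge => /orP[]/eqP ->; [left|right].
- exact: off F1z.
- exact: off F2z.
- exact: off F3z.
- exact: component_trans (component_sym m1) m2.
- exact: component_trans (component_sym m1) m3.
- by rewrite -dE => h; apply: Or31; exact: same_connected_component.
- by rewrite -dE => h; apply: Or32; exact: same_connected_component.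
- by rewrite -dE => h; apply: Or33; exact: same_connected_component.
Qed.

End Faces.

(** * The two implications *)

Section Main.
Context {R : realType} {T : finType} {E : {set {set T}}} (G : plane_embedding R E).
Hypothesis E_simple : simple_graph E.
Implicit Types (x y v : T) (p c : seq T) (f g : {set T}) (F : set (R * R)).
Implicit Types M N : {set {set T}}.

Notation arcs := (arcs G).
Notation side c z := (component (arcs (cycle_edges c)) z).

Lemma matching_cover M : perfect_matching E M -> forall v, exists2 f, f \in E & v \in f.
Proof.
move=> Mpm v; exists (edge v (mate M v)); last by rewrite in_edge eqxx.
exact: (mate_adj E_simple Mpm).
Qed.

Lemma perfect_matchingS (E' : {set {set T}}) M : E' \subset E ->
  perfect_matching E' M -> perfect_matching E M.
Proof.
move=> EE /andP[ME Mx]; apply/andP; split=> //; exact: fintype.subset_trans EE.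
Qed.

Lemma three_vertices x y z : x != y -> x != z -> y != z -> (2 < #|T|)%N.
Proof.
move=> xy xz yz; have u : uniq [:: x; y; z] by rewrite /= !inE negb_or xy xz yz.
by have := max_card (mem [:: x; y; z]); rewrite (card_uniqP u).
Qed.

Section Directed.
Variable A : {set T}.
Hypothesis A_bip : forall x y, adj E x y -> (x \in A) != (y \in A).
Variable M : {set {set T}}.
Notation D := (darc E A M).

Lemma dcycle_exists u v : D u v -> connect D v u -> exists2 c, is_cycle E c & cycle D c.
Proof.
move=> duv /connectP[p pp e]; move: duv; rewrite e => {e}.
case/shortenP: pp => q qq uq _ dlv.
have dc : cycle D (v :: q) by rewrite /= rcons_path qq.
have ac : cycle (adj E) (v :: q) by apply: sub_cycle dc => a b; exact: darc_adj.
exists (v :: q) => //; rewrite /is_cycle uq ac !andbT.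
case: q qq dlv {uq dc ac} => [|a [|//]] /=.
  by move=> _ /darc_adj /(adj_neq E_simple); rewrite eqxx.
by rewrite andbT => dva /(darc_antisym A_bip); rewrite dva.
Qed.

End Directed.

(** Exchanging [M] along an alternating cycle that avoids [f] would give a second
    perfect matching without [f]. So all alternating cycles, in particular the
    boundaries of the resonant faces, pass through [f] and through the matching
    edges at its ends. *)
Lemma anti_forcing_resonant f : elementary E -> bipartite E -> anti_forcing_edge E f ->
  exists M, perfect_matching E M /\
     exists F1 F2 : set (R * R),
       [/\ F1 <> F2,
           forall F, resonant_face G M F <-> F = F1 \/ F = F2 &
           exists (x : T) (p : seq T),
             common_boundary_path G F1 F2 x p /\ (3 <= size p)%N].
Proof.
move=> el [A A_bip] [fE [M [Mpm' Muniq]]].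
have Mpm : perfect_matching E M.
  by apply: perfect_matchingS Mpm'; exact: subD1set.
have fM : f \notin M.
  apply/negP => fM; have /andP[/fintype.subsetP/(_ f fM)] := Mpm'.
  by rewrite !inE eqxx.
have [u [v [fuv uv _ _]]] := edge_arc_ends_neq G E_simple fE.
have uvE : adj E u v by rewrite /adj -fuv.
have umv : mate M u != v.
  by apply: contraNneq fM => muv; rewrite fuv -muv; exact: (mateP E_simple Mpm).
have T2 : (2 < #|T|)%N.
  apply: (three_vertices uv _ _ (z := mate M u)); first by rewrite eq_sym; exact: (mate_neq E_simple Mpm).
  by rewrite eq_sym.
have cover := matching_cover Mpm.
have strong := strongly_connected E_simple A_bip el Mpm T2.
have [c cc dc] : exists2 c, is_cycle E c & cycle (darc E A M) c.
  by case/orP: (darc_orient A_bip M uvE) => d; apply: (dcycle_exists A_bip d).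
have [a [b [Ja Jb nab]]] := cycle_separates G E_simple cc.
have [F1 rF1 F1a] := resonant_in_side E_simple A_bip Mpm strong cover cc dc Ja.
have [F2 rF2 F2b] := resonant_in_side E_simple A_bip Mpm strong cover cc dc Jb.
have F12 : F1 <> F2.
  move=> e; have [q F1q] := face_nonempty rF1.1.
  apply: nab; apply: component_trans (F1a _ F1q) (component_sym (F2b _ _)).
  by rewrite -e.
have onf c' : alternating_cycle E M c' -> f \in cycle_edges c'.
  move=> alt; apply: contrapT => /negP fc'.
  have [N Npm NM] := alternating_cycle_swap E_simple Mpm alt fc' fM.
  by apply: NM; rewrite (Muniq _ Npm).
have frf F : resonant_face G M F -> arc_set G f `<=` frontier F.
  move=> [_ [c' alt ->]] w fw; exists f => //; exact: onf.
exists M; split=> //; exists F1, F2; split=> //.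
  move=> F; split=> [rF|[->|->] //].
  have [||] := two_faces_at_edge E_simple cover fE rF1.1 rF2.1 rF.1 (frf _ rF1) (frf _ rF2) (frf _ rF).
  - by move=> /F12.
  - by left.
  - by right.
exists (mate M u), [:: u; v; mate M v]; split=> //; split.
  have muv : mate M u != mate M v.
    apply: contra_neq uv => e.
    by rewrite -(mateK E_simple Mpm u) e (mateK E_simple Mpm).
  have umv' : u != mate M v by apply: contraNneq umv => ->; rewrite (mateK E_simple Mpm).
  rewrite /is_path /= !inE !negb_or (mate_neq E_simple Mpm) umv muv uv umv' /=.
  rewrite (eq_sym v) (mate_neq E_simple Mpm) /= uvE (mate_adj E_simple Mpm) !andbT.
  by rewrite /adj edgeC; exact: (mate_adj E_simple Mpm).
have pc c' g : alternating_cycle E M c' -> g \in path_edges (mate M u) [:: u; v; mate M v] ->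
    g \in cycle_edges c'.
  move=> alt; have fc' := onf c' alt; have u' := alternating_uniq alt.
  have uc' : u \in c'.
    by have [] := cycle_edges_at u' fc' (x := u); rewrite // fuv in_edge eqxx.
  have vc' : v \in c'.
    by have [] := cycle_edges_at u' fc' (x := v); rewrite // fuv in_edge eqxx orbT.
  rewrite !inE => /or3P[]/eqP ->; last exact: (alternating_mate E_simple).
    by rewrite edgeC; exact: (alternating_mate E_simple).
  by rewrite -fuv.
move=> g gp; have [_ [c1 alt1 e1]] := rF1; have [_ [c2 alt2 e2]] := rF2.
by split; [rewrite e1|rewrite e2] => w gw; exists g => //; exact: pc gp.
Qed.

(** One of the first two edges of the path is not in [M]. If a second perfect
    matching avoided it, so would an alternating cycle; both faces touch the edge
    and hence lie in the side of the cycle that contains it, but there is a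
    resonant face in the other side as well. *)
Lemma resonant_anti_forcing M F1 F2 x p : elementary E -> bipartite E ->
  perfect_matching E M -> F1 <> F2 ->
  (forall F, resonant_face G M F <-> F = F1 \/ F = F2) ->
  common_boundary_path G F1 F2 x p -> (3 <= size p)%N ->
  exists f, anti_forcing_edge E f.
Proof.
move=> el [A A_bip] Mpm F12 rF [/andP[up pp] pF] p3.
have [rF1 rF2] : resonant_face G M F1 /\ resonant_face G M F2.
  by split; apply/rF; [left|right].
have cover := matching_cover Mpm.
case: p p3 up pp pF => [//|a [//|b p]] _ up /= /and3P[xa ab pp] pF.
have [xab [xna anb]] : x != b /\ x != a /\ a != b.
  by move: up; rewrite /= !inE !negb_or => /and3P[/and3P[-> -> _] /andP[-> _] _].
have T2 : (2 < #|T|)%N by exact: three_vertices xna xab anb.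
have strong := strongly_connected E_simple A_bip el Mpm T2.
have [f [fE fM fF1 fF2]] : exists f, [/\ f \in E, f \notin M,
    arc_set G f `<=` frontier F1 & arc_set G f `<=` frontier F2].
  have [xaM|xaM] := boolP (edge x a \in M); last first.
    by exists (edge x a); have [] := pF (edge x a) (mem_head _ _).
  exists (edge a b); have [|? ?] := pF (edge a b); first by rewrite !inE eqxx orbT.
  split=> //; apply: contra xab => abM; rewrite edgeC in xaM.
  by rewrite -(mate_unique E_simple Mpm xaM) (mate_unique E_simple Mpm abM).
exists f; split=> //; exists M; split.
  have /andP[ME Mx] := Mpm; apply/andP; split=> //.
  by apply/fintype.subsetP => g gM; rewrite !inE (matching_sub Mpm gM) andbT; apply: contraNneq fM => <-.
move=> N Npm'; apply: contrapT => MN.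
have Npm : perfect_matching E N by apply: perfect_matchingS Npm'; exact: subD1set.
have [c [cc dc cMN]] := two_matchings_dcycle E_simple A_bip Mpm Npm MN.
have fc : f \notin cycle_edges c.
  apply/negP => /cMN; rewrite inE (negbTE fM) /= => fN.
  have /andP[/fintype.subsetP/(_ f fN)] := Npm'.
  by rewrite !inE eqxx.
have Jm : ~ arcs (cycle_edges c) (midpoint G f).
  exact: (edge_point_off_cycle cc fE fc (half_in)).
have cJ := cycle_arcs_closed (G := G) cc.
have JD := cycle_sub_drawing (G := G) cc.
have [w Jw mw] := cycle_other_side E_simple cc Jm.
have [F3 rF3 F3w] := resonant_in_side E_simple A_bip Mpm strong cover cc dc Jw.
have [q F3q] := face_nonempty rF3.1.
have wq := F3w q F3q.
apply: mw; apply: component_trans (component_sym wq).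
have /rF[e|e] := rF3.
  by apply: (face_in_component rF1.1 fF1 cJ JD Jm); rewrite -e.
by apply: (face_in_component rF2.1 fF2 cJ JD Jm); rewrite -e.
Qed.

End Main.

Theorem theorem2p4 (R : realType) (T : finType) (E : {set {set T}})
    (G : plane_embedding R E) :
  simple_graph E -> elementary E -> bipartite E ->
  (exists f, anti_forcing_edge E f) <->
  (exists M, perfect_matching E M /\
     exists F1 F2 : set (R * R),
       [/\ F1 <> F2,
           forall F, resonant_face G M F <-> F = F1 \/ F = F2 &
           exists (x : T) (p : seq T),
             common_boundary_path G F1 F2 x p /\ (3 <= size p)%N]).
Proof.
move=> E_simple el bip; split.
  by move=> [f]; exact: anti_forcing_resonant.
move=> [M [Mpm [F1 [F2 [F12 rF [x [p [pF p3]]]]]]]].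
exact: resonant_anti_forcing Mpm F12 rF pF p3.
Qed.
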